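(* Consider all-pay auctions with prescreening and $m\ge2$ potential bidders. Suppose an SSM equilibrium strategy exists for all $n\in\{2,\dots,m\}$. Let $n^\ast$ denote a number of admitted bidders maximizing the expected highest bid $\mathrm{HB}(n;F)=\mathbb E[\sigma^{\mathrm{AP}}(\max_kV_k;n,F)]$ over $n\in\{2,\dots,m\}$. (i) Under the perfect predictor, $n^\ast=2$. (ii) Under the null predictor with prior $F_1(x)=x^c$, $c>0$: if $c\in(0,3]$ then $n^\ast=m$; if $c\in\big(3,\frac{5+\sqrt{33}}2\big)$ then $n^\ast=\min\big\{m,\frac{c^2-c+2}{c^2-3c}\big\}$, where, when $\frac{c^2-c+2}{c^2-3c}$ is not an integer, $n^\ast$ is either $\min\big\{m,\big\lceil\frac{c^2-c+2}{c^2-3c}\big\rceil\big\}$ or $\min\big\{m,\big\lfloor\frac{c^2-c+2}{c^2-3c}\big\rfloor\big\}$; if $c\ge\frac{5+\sqrt{33}}2$ then $n^\ast=2$.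
   Context: Model. There are $m\ge2$ risk-neutral potential bidders. The valuation–signal pairs $(V_i,S_i)\in[0,1]^2$ are independent across bidders with common joint CDF $F$ (the ''predictor''), whose marginal CDFs $F_1$ (valuations, the prior) and $F_2$ (signals) have strictly positive densities $f_1,f_2$. The seller commits ex ante to $n\in\{2,\dots,m\}$ and admits the $n$ bidders with the highest signals. Bidders know only their own valuation and the admitted set. The admitted valuations $V=(V_1,\dots,V_n)$ have joint density $g(v;n,F)=\binom mn\psi(v;n,F)\prod_{j=1}^nf_1(v_j)$ on $[0,1]^n$; here, for the perfect predictor $F(v,s)=\min\{F_1(v),F_2(s)\}$, $\psi(v;n,F)=F_1(\min_kv_k)^{m-n}$, and for the null predictor $F(v,s)=F_1(v)F_2(s)$, $\psi\equiv1/\binom mn$. An admitted bidder with valuation $v_i$ has belief $g(v_{-i}\mid v_i;n,F)$ (conditional density). Let $H(x\mid v_i;n,F)=\int_{[0,x]^{n-1}}g(v_{-i}\mid v_i;n,F)dv_{-i}$, $h=\partial H/\partial x$. All-pay auction: the highest bidder wins; every admitted bidder pays her bid. An SSM equilibrium strategy is a differentiable strictly increasing $\sigma:[0,1]\to\mathbb R_+$ such that for every $v_i$, $\sigma(v_i)$ maximizes $\Pr\{\sigma(V_j)<b\ \forall j\ne i\}v_i-b$ over $b\ge0$, $V_{-i}\sim g(\cdot\mid v_i;n,F)$. When it exists it is unique and equals $\sigma^{\mathrm{AP}}(v;n,F)=\int_0^vx\,h(x\mid x;n,F)dx$.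
   Formalization: When (c²−c+2)/(c²−3c) is an integer smaller than m (including c=(5+√33)/2 with m≥3), that integer and its successor tie, so the given value is only claimed to be a maximizer; elsewhere every maximizer is as stated. *)

(* Defs.v *)
From HB Require Import structures.
From mathcomp Require Import all_boot all_order all_algebra.
(* MathComp-Analysis *)
From mathcomp Require Import all_classical all_reals all_analysis.

Set Implicit Arguments.
Unset Strict Implicit.
Unset Printing Implicit Defensive.

Import Order.TTheory GRing.Theory Num.Theory.
Import numFieldNormedType.Exports.

Local Open Scope classical_set_scope.
Local Open Scope ring_scope.

Definition joint_cdf (R : realType) (P : probability (R * R)%type R)
  (v s : R) : R := fine (P (`]-oo, v] `*` `]-oo, s])).

Definition marginal1 (R : realType) (P : probability (R * R)%type R)
  (v : R) : R := fine (P (`]-oo, v] `*` setT)).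

Definition marginal2 (R : realType) (P : probability (R * R)%type R)
  (s : R) : R := fine (P (setT `*` `]-oo, s])).

(* [f] is only required to be positive on ]0, 1]: the priors [x `^ c] with
   1 < c have a density that vanishes at 0. *)
Definition has_pos_density (R : realType) (G f : R -> R) : Prop :=
  [/\ measurable_fun (`[0, 1] : set R) f,
      forall x, 0 < x <= 1 -> 0 < f x &
      forall x, 0 <= x <= 1 ->
        (G x)%:E = (\int[lebesgue_measure]_(t in `[0%R, x]) (f t)%:E)%E].

(* The common law of the valuation-signal pairs (V_i, S_i), with a chosen
   version of the two marginal densities. *)
Record predictor (R : realType) := Predictor {
  law : probability (R * R)%type R ;
  f1 : R -> R ;
  f2 : R -> R ;
  law_unit_square : law ((`[0, 1] : set R) `*` (`[0, 1] : set R)) = 1%E ;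
  f1_density : has_pos_density (marginal1 law) f1 ;
  f2_density : has_pos_density (marginal2 law) f2
}.

Section Predictors.
Variable R : realType.
Implicit Types F : predictor R.

Definition cdf12 F (v s : R) : R := joint_cdf (law F) v s.
Definition F1 F (v : R) : R := marginal1 (law F) v.
Definition F2 F (s : R) : R := marginal2 (law F) s.

Definition perfect F : Prop := forall v s : R, 0 <= v <= 1 -> 0 <= s <= 1 ->
  cdf12 F v s = Num.min (F1 F v) (F2 F s).

Definition null F : Prop := forall v s : R, 0 <= v <= 1 -> 0 <= s <= 1 ->
  cdf12 F v s = F1 F v * F2 F s.

(* Valuation profiles in [0, 1]^n are sequences of size n, so that the neutral
   elements 1 and 0 below are harmless. *)
Definition minval (v : seq R) : R := \big[Num.min/1]_(x <- v) x.
Definition maxval (v : seq R) : R := \big[Num.max/0]_(x <- v) x.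

(* The factor psi(v; n, F), for a perfect and for a null F respectively. *)
Definition psi_perfect (m n : nat) F (v : seq R) : R :=
  F1 F (minval v) ^+ (m - n).
Definition psi_null (m n : nat) F (v : seq R) : R := ('C(m, n)%:R)^-1.

(* The integral of [f] over the cube [0, a]^k, as an iterated Lebesgue
   integral; it is only applied to nonnegative integrands. *)
Fixpoint cube_integral (k : nat) (a : R) (f : seq R -> R) : \bar R :=
  if k is k'.+1
  then (\int[lebesgue_measure]_(t in `[0%R, a])
          cube_integral k' a (fun w => f (t :: w)))%E
  else (f [::])%:E.

End Predictors.

Section AllPay.
Variables (R : realType) (m : nat) (F : predictor R).
Variable psi : nat -> nat -> predictor R -> seq R -> R.
Implicit Types n : nat.

Definition g n (v : seq R) : R :=
  'C(m, n)%:R * psi m n F v * \prod_(x <- v) f1 F x.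

(* [g n] being symmetric, the beliefs are the same for all admitted bidders;
   they are written for the one whose valuation comes first. The marginal in
   the denominator may vanish at [vi = 0]; the belief is then 0, which is
   immaterial since it enters the payoff multiplied by [vi]. *)
Definition belief n (vi : R) (w : seq R) : R :=
  g n (vi :: w) / fine (cube_integral n.-1 1 (fun w' => g n (vi :: w'))).

Definition H n (x vi : R) : R := fine (cube_integral n.-1 x (belief n vi)).

Definition h n (x vi : R) : R := derive1 (fun y => H n y vi) x.

Definition win_prob n (sigma : R -> R) (b vi : R) : R :=
  fine (cube_integral n.-1 1
    (fun w => (all (fun x => sigma x < b) w)%:R * belief n vi w)).

Definition payoff n (sigma : R -> R) (b vi : R) : R :=
  win_prob n sigma b vi * vi - b.

(* Derivatives at the endpoints 0 and 1 are one-sided. *)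
Definition differentiable01 (sigma : R -> R) : Prop :=
  forall x, 0 <= x <= 1 -> exists l : R,
    (sigma y - sigma x) / (y - x) @[y --> within `[0, 1] x^'] --> l.

Definition SSM n (sigma : R -> R) : Prop :=
  [/\ differentiable01 sigma,
      forall x y, 0 <= x -> x < y -> y <= 1 -> sigma x < sigma y,
      forall x, 0 <= x <= 1 -> 0 <= sigma x &
      forall vi b, 0 <= vi <= 1 -> 0 <= b ->
        payoff n sigma b vi <= payoff n sigma (sigma vi) vi].

Definition sigmaAP n (v : R) : R :=
  \int[lebesgue_measure]_(x in `[0, v]) (x * h n x x).

Definition HB n : \bar R :=
  cube_integral n 1 (fun v => sigmaAP n (maxval v) * g n v).

Definition SSM_exists : Prop :=
  forall n, (2 <= n <= m)%N -> exists sigma, SSM n sigma.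

Definition HB_maximizer n : Prop :=
  (2 <= n <= m)%N /\ forall k, (2 <= k <= m)%N -> (HB k <= HB n)%E.

End AllPay.

(* Main.v *)
Require Import Defs.
From HB Require Import structures.
From mathcomp Require Import all_boot all_order all_algebra.
From mathcomp Require Import all_classical all_reals all_analysis.
From mathcomp Require Import measurable_realfun ring lra zify.

(** In both cases [g n v = 'C(p + n, p) * F1 (min v) ^ p * prod f1 v], with
    [p = m - n] (perfect) or [p = 0] (null). In the quantile scale [u = F1 v]
    the bidders are uniform, and everything reduces to the polynomials
    [phi p k y s = E(min(s, U_1, .., U_k) ^ p; U_1, .., U_k <= y)].
    They give [h n x x = N u ^ (N - 1) f1 x / P(Bin(N, u) >= p)] with
    [u = F1 x], [N = p + n - 1], and the maximum of the selected valuations has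
    distribution function [F1 ^ (p + n)], so that, integrating by parts,
    [HB n = int_0^1 x h n x x (1 - F1 x ^ (p + n)) dx].
    For the perfect predictor, [N = m - 1] and [p + n = m] do not depend on [n],
    and [P(Bin(m - 1, u) >= m - n)] is smallest at [n = 2].
    For the null predictor and [F1 x = x ^ c],
    [HB n = c^2 n (n - 1) / (((n - 1) c + 1) ((2 n - 1) c + 1))], and
    [HB (n + 1) - HB n] has the sign of [c^2 - c + 2 - n (c^2 - 3 c)]. *)

Set Implicit Arguments.
Unset Strict Implicit.
Unset Printing Implicit Defensive.

Import Order.TTheory GRing.Theory Num.Theory.
Import numFieldNormedType.Exports.

Local Open Scope classical_set_scope.
Local Open Scope ring_scope.

(** * Binomial tails and truncated powers of the minimum *)

Section BinomialTail.
Variable R : realType.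
Implicit Types (y s u v : R) (P Q : {poly R}) (N p k : nat).

(* At [y = 1], the probability that a binomial variable [Bin(N, s)] is [< p]. *)
Definition bsum N p y : {poly R} :=
  \sum_(j < p) 'C(N, j)%:R *: ('X^j * (y%:P - 'X) ^+ (N - j)).

Lemma horner_bsum N p y s : (bsum N p y).[s] =
  \sum_(j < p) 'C(N, j)%:R * (s ^+ j * (y - s) ^+ (N - j)).
Proof.
rewrite /bsum horner_sum; apply: eq_bigr => j _.
by rewrite !hornerE.
Qed.

(** The derivatives telescope: by [mul_bin_left] the negative half of each term's derivative cancels
    the positive half of the next, and only the negative half of the last term survives. *)
Lemma deriv_bsum N p y : (p <= N)%N ->
  (bsum N p y)^`() = - (p * 'C(N, p))%:R *: ('X^(p.-1) * (y%:P - 'X) ^+ (N - p)).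
Proof.
elim: p => [_|p IH pN]; first by rewrite /bsum big_ord0 deriv0 mul0n oppr0 scale0r.
rewrite /bsum big_ord_recr /= derivD -/(bsum N p y) IH; last exact: ltnW.
rewrite derivZ derivM derivXn deriv_exp derivB derivC derivX sub0r.
rewrite mulNr mul1r.
have -> : (N - p = (N - p.+1).+1)%N by lia.
rewrite [_.+1.-1]/= mul_bin_left.
set A := (y%:P - 'X); rewrite -!mul_polyC.
have -> : (N - p = (N - p.+1).+1)%N by lia.
rewrite !natrM !polyCN !polyCM !polyC_natr.
rewrite -['X^_ *+ p]mulr_natr -[_ *+ (N - p.+1).+1]mulr_natr.
by case: p IH pN => [|p] IH pN /=; rewrite !exprS; ring.
Qed.

Lemma bsum_full N y s : (bsum N N.+1 y).[s] = y ^+ N.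
Proof.
rewrite horner_bsum -[y in RHS](subrK s) exprDn; apply: eq_bigr => j _.
by rewrite mulr_natl [s ^+ j * _]mulrC.
Qed.

(** For [0 <= s <= y <= 1], read the [p]-th power as [p] further uniforms. Up to ties, they lie
    below [s] and below every [U_i], with all [U_i <= y], exactly when all [p + k] points are at
    most [y], at least [p] of them are at most [s], and the [p] smallest are the added ones. By
    exchangeability the last condition costs the factor [1 / 'C(p + k, p)]. *)
Definition phi p k y : {poly R} :=
  'C(p + k, p)%:R^-1 *: ((y ^+ (p + k))%:P - bsum (p + k) p y).

Lemma hornerphi p k y s : (phi p k y).[s] =
  'C(p + k, p)%:R^-1 * (y ^+ (p + k) - (bsum (p + k) p y).[s]).
Proof. by rewrite /phi hornerZ hornerD hornerN hornerC. Qed.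

Lemma binC_neq0 p k : 'C(p + k, p)%:R != 0 :> R.
Proof. by rewrite pnatr_eq0 -lt0n bin_gt0 leq_addr. Qed.

Lemma bsum_at N p y : (p <= N)%N -> (bsum N p y).[y] = 0.
Proof.
move=> pN; rewrite horner_bsum big1 // => j _.
by rewrite subrr expr0n subn_eq0 leqNgt (leq_trans (ltn_ord j) pN) mulr0 mulr0.
Qed.

Lemma phi_diag p k y : (phi p k y).[y] = 'C(p + k, p)%:R^-1 * y ^+ (p + k).
Proof. by rewrite hornerphi bsum_at ?leq_addr // subr0. Qed.

Lemma bsum0 N p y : (bsum N p y).[0] = if p is 0 then 0 else y ^+ N.
Proof.
rewrite horner_bsum; case: p => [|p]; first by rewrite big_ord0.
rewrite big_ord_recl big1 ?addr0 /=; last by move=> i _; rewrite expr0n mul0r mulr0.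
by rewrite bin0 expr0 subr0 subn0 !mul1r.
Qed.

Lemma phi_at0 p k y : (phi p k y).[0] = if p is 0 then y ^+ k else 0.
Proof.
rewrite hornerphi bsum0; case: p => [|p]; rewrite ?subrr ?mulr0 //.
by rewrite bin0 invr1 mul1r subr0.
Qed.

Lemma phi0 p y s : (phi p 0 y).[s] = s ^+ p.
Proof.
rewrite hornerphi addn0 binn invr1 mul1r.
rewrite -(bsum_full p y s) 2!horner_bsum big_ord_recr /=.
by rewrite addrAC subrr add0r subnn expr0 mulr1 binn mul1r.
Qed.

(** Only outcomes with every [U_i] in []s, y]] react to [s], whence the factor [(y - s) ^ k]. *)
Lemma deriv_phi p k y : (phi p k y)^`() = p%:R *: ('X^(p.-1) * (y%:P - 'X) ^+ k).
Proof.
rewrite /phi derivZ derivB derivC sub0r deriv_bsum ?leq_addr //.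
rewrite addKn scaleNr opprK scalerA natrM mulrC mulfK //.
exact: binC_neq0.
Qed.

(* Conditioning on the last variable: [phi p k.+1 y] at [s] is the integral of
   [phi p k y] over [0, s] plus [(y - s) phi p k y] at [s]. *)
Lemma deriv_phiS p k y :
  (phi p k.+1 y - (y%:P - 'X) * phi p k y)^`() = phi p k y.
Proof.
rewrite derivB derivM !deriv_phi derivB derivC derivX -!mul_polyC exprS; ring.
Qed.

(** The binomial expansion of [y ^ (p + k)] turns the difference into the complementary tail, whose
    terms are nonnegative for [0 <= s <= y]. *)
Lemma phi_sumE p k y s : (phi p k y).[s] = 'C(p + k, p)%:R^-1 *
  \sum_(i < k.+1) 'C(p + k, p + i)%:R * (s ^+ (p + i) * (y - s) ^+ (k - i)).
Proof.
rewrite hornerphi -(bsum_full (p + k) y s) !horner_bsum -addnS big_split_ord /=.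
rewrite addrAC subrr add0r; congr (_ * _); apply: eq_bigr => i _.
by rewrite subnDl.
Qed.

Lemma phi_ge0 p k y s : 0 <= s <= y -> 0 <= (phi p k y).[s].
Proof.
move=> /andP[s0 sy]; rewrite phi_sumE mulr_ge0 ?invr_ge0 // sumr_ge0 // => i _.
by rewrite !mulr_ge0 // exprn_ge0 // subr_ge0.
Qed.

Lemma phi_itv p k y s : 0 <= s -> s <= y -> y <= 1 -> 0 <= (phi p k y).[s] <= 1.
Proof.
move=> s0 sy y1; rewrite phi_ge0 ?s0//= hornerphi.
have b1 : (bsum (p + k) p y).[s] >= 0.
  by rewrite horner_bsum sumr_ge0// => i _; rewrite !mulr_ge0// exprn_ge0// subr_ge0.
rewrite ler_pdivrMl ?mulr1 ?ltr0n ?bin_gt0 ?leq_addr// lerBlDr.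
have yn : y ^+ (p + k) <= 1 by rewrite exprn_ile1// (le_trans s0).
by rewrite (le_trans yn)// -[leLHS]addr0 lerD// ler1n bin_gt0 leq_addr.
Qed.

Lemma leq_bin_shift p k i : ('C(k, i) <= 'C(p + k, p + i))%N.
Proof. by elim: p => [//|p IH]; rewrite !addSn binS (leq_trans IH) // leq_addl. Qed.

(** If the first [p] of [p + k] trials succeed, then at least [p] do; analytically, a termwise
    comparison with [u ^ p (u + (1 - u)) ^ k]. This keeps [hazard] bounded near 0. *)
Lemma bsum_lower p k u : 0 <= u <= 1 -> u ^+ p <= 1 - (bsum (p + k) p 1).[u].
Proof.
move=> /andP[u0 u1]; have := hornerphi p k 1 u; rewrite phi_sumE expr1n.
move=> /(mulfI _) <-; last by rewrite invr_eq0 binC_neq0.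
have -> : u ^+ p = \sum_(i < k.+1) u ^+ p * ('C(k, i)%:R * (u ^+ i * (1 - u) ^+ (k - i))).
  rewrite -mulr_sumr -horner_bsum bsum_full expr1n mulr1 //.
apply: ler_sum => i _; rewrite mulrCA [u ^+ p * _]mulrA -exprD.
by rewrite ler_wpM2r ?ler_nat ?leq_bin_shift // mulr_ge0 // exprn_ge0 // subr_ge0.
Qed.

Lemma bsum_lt N p q u : (p < q <= N)%N -> 0 < u < 1 ->
  (bsum N p 1).[u] < (bsum N q 1).[u].
Proof.
move=> /andP[pq qN] /andP[u0 u1]; rewrite !horner_bsum.
rewrite -(subnKC pq) addSnnS big_split_ord /= ltrDl big_ord_recl /=.
have h (j : nat) : (j <= N)%N -> 0 < 'C(N, j)%:R * (u ^+ j * (1 - u) ^+ (N - j)).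
  by move=> jN; rewrite !mulr_gt0 ?ltr0n ?bin_gt0 ?exprn_gt0 ?subr_gt0.
rewrite ltr_pwDl ?sumr_ge0 //; first by apply: h; lia.
by move=> i _; apply/ltW/h; rewrite /bump /=; have := ltn_ord i; lia.
Qed.

(** Each term carries [z - min u z] to a power at least 2, since [j < p]. Hence the kink of the
    minimum does not contribute to the derivative at [z = u] in [h_diag]. *)
Lemma bsum_quadratic p k : exists2 L, 0 <= L & forall u z,
  0 <= u <= 1 -> 0 <= z <= 1 ->
  `|(bsum (p + k.+1) p z).[Num.min u z]| <= L * (z - u) ^+ 2.
Proof.
exists (\sum_(j < p) 'C(p + k.+1, j)%:R) => [|u z /andP[u0 u1] /andP[z0 z1]].
  by rewrite sumr_ge0.
rewrite horner_bsum mulr_suml (le_trans (ler_norm_sum _ _ _)) //.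
apply: ler_sum => j _; rewrite normrM normr_nat ler_wpM2l //.
have [zu|uz] := leP z u.
  rewrite subrr expr0n (_ : (_ == 0)%N = false) ?mulr0 ?normr0 ?sqr_ge0 //.
  by have := ltn_ord j; lia.
have -> : (p + k.+1 - j = (p + k.+1 - j - 2) + 2)%N by have := ltn_ord j; lia.
rewrite ger0_norm ?exprD ?mulrA; last first.
  by rewrite !mulr_ge0 ?exprn_ge0 // ?subr_ge0 // ltW.
rewrite -[_ * _ * _ * _]mulrA -expr2.
by rewrite ler_piMl ?sqr_ge0 // mulr_ile1 ?exprn_ge0 ?exprn_ile1 ?subr_ge0//; lra.
Qed.

Lemma poly_lipschitz P : exists2 L, 0 <= L & forall u v,
  0 <= u <= 1 -> 0 <= v <= 1 -> `|P.[v] - P.[u]| <= L * `|v - u|.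
Proof.
(* The induction along [P * 'X + c] needs a bound [B] on [|P|] besides the Lipschitz constant. *)
suff [L [B [L0 B0 LB]]] : exists L B, [/\ 0 <= L, 0 <= B & forall u v,
    0 <= u <= 1 -> 0 <= v <= 1 -> `|P.[u]| <= B /\
    `|P.[v] - P.[u]| <= L * `|v - u|].
  by exists L => // u v u01 v01; have [] := LB u v u01 v01.
elim/poly_ind: P => [|P c [L [B [L0 B0 LB]]]].
  exists 0, 0; split=> // u v _ _.
  by rewrite !horner0 subrr normr0 mul0r.
exists (L + B), (B + `|c|); split; rewrite ?addr_ge0 //.
move=> u v u01 v01; have [Bu Luv] := LB u v u01 v01; rewrite !hornerE; split.
  rewrite (le_trans (ler_normD _ _)) // lerD2r normrM.
  by rewrite (le_trans _ Bu)// ler_piMr// ger0_norm; lra.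
have -> : P.[v] * v + c - (P.[u] * u + c) = (P.[v] - P.[u]) * v + P.[u] * (v - u) by ring.
rewrite (le_trans (ler_normD _ _)) // !normrM mulrDl lerD //.
  by rewrite (le_trans _ Luv)// ler_piMr// ger0_norm; lra.
by rewrite ler_wpM2r.
Qed.

Lemma poly_bounded P : exists M, forall u, 0 <= u <= 1 -> `|P.[u]| <= M.
Proof.
have [L L0 PL] := poly_lipschitz P; exists (L + `|P.[0]|) => u u01.
rewrite -(subrK P.[0] P.[u]) (le_trans (ler_normD _ _))// lerD2r.
rewrite (le_trans (PL 0 _ _ _)) ?lexx ?ler01//.
by rewrite subr0 ger0_norm ?ler_piMr//; lra.
Qed.

Lemma poly_taylor1 P : exists2 L, 0 <= L & forall u v,
  0 <= u <= 1 -> 0 <= v <= 1 ->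
  `|P.[v] - P.[u] - P^`().[u] * (v - u)| <= L * (v - u) ^+ 2.
Proof.
elim/poly_ind: P => [|P c [L L0 PL]].
  exists 0 => // u v _ _.
  by rewrite deriv0 !horner0 subrr mul0r subrr normr0 mul0r.
have [B B0 PB] := poly_lipschitz (P^`()).
exists (L + (B + `|P^`().[0]|)); first by rewrite !addr_ge0.
move=> u v u01 v01.
have -> : (P * 'X + c%:P).[v] - (P * 'X + c%:P).[u] - (P * 'X + c%:P)^`().[u] * (v - u) =
   (P.[v] - P.[u] - P^`().[u] * (v - u)) * v + P^`().[u] * (v - u) ^+ 2.
  by rewrite derivD derivM derivX derivC !(hornerD, hornerM, hornerX, hornerC); ring.
rewrite (le_trans (ler_normD _ _)) // [leRHS]mulrDl lerD // normrM.
  by rewrite (le_trans _ (PL u v u01 v01))// ler_piMr// ger0_norm; lra.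
rewrite (ger0_norm (sqr_ge0 _)) ler_wpM2r ?sqr_ge0//.
rewrite -[P^`().[u]](subrK P^`().[0]) (le_trans (ler_normD _ _))// lerD2r.
rewrite (le_trans (PB 0 u _ _)) //; first by rewrite lexx ler01.
by rewrite subr0 ler_piMr// ger0_norm; lra.
Qed.

End BinomialTail.

(** * Complements on the Lebesgue integral *)

Section IntegralExtras.
Import HBNNSimple.
Variable R : realType.
Notation mu := (@lebesgue_measure R).

Lemma integrable_bounded_mul (D : set R) (h f : R -> R) (M : R) :
  measurable D -> measurable_fun D h -> (forall x, D x -> `|h x| <= M) ->
  mu.-integrable D (EFin \o f) ->
  mu.-integrable D (EFin \o (fun x => h x * f x)).
Proof.
move=> mD mh hM intf; have mf := measurable_int _ intf.
have := integrableZl _ M intf => /(_ mD) intMf.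
apply: (@le_integrable _ _ _ mu _ _ _ _ _ _ intMf) => //.
  by apply/measurable_EFinP/measurable_funM => //; exact/measurable_EFinP.
move=> x Dx; rewrite /= lee_fin !normrM ler_wpM2r //.
by rewrite (le_trans (hM _ Dx)) // ler_norm.
Qed.

Lemma integral_gt0 (D : set R) (f : R -> R) :
  measurable D -> (0 < mu D)%E -> measurable_fun D f ->
  (forall x, D x -> 0 < f x) -> (0 < \int[mu]_(x in D) (f x)%:E)%E.
Proof.
move=> mD D0 mf f0.
have If : (0 <= \int[mu]_(x in D) (f x)%:E)%E.
  by apply: integral_ge0 => x Dx; rewrite lee_fin ltW// f0.
rewrite lt_neqAle If andbT; apply/negP => /eqP If0.
have mEf : measurable_fun D (EFin \o f) by exact/measurable_EFinP.
have /(ae_eq_integral_abs mu mD mEf) : (\int[mu]_(x in D) `|(EFin \o f) x| = 0)%E.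
  rewrite [RHS]If0; apply: eq_integral => x /set_mem Dx /=.
  by rewrite gtr0_norm// f0.
case=> N [mN N0 DN]; suff : (mu D <= 0)%E by rewrite leNgt D0.
rewrite -N0 le_measure ?inE// => x Dx; apply: DN => /= /(_ Dx) [].
by move/eqP; rewrite gt_eqF// f0.
Qed.

Lemma measurable_horner (P : {poly R}) : measurable_fun setT (fun x => P.[x]).
Proof.
apply: continuous_measurable_fun => x; exact: continuous_horner.
Qed.

(* [f] need not be measurable: this is applied to [x * h n x x], about which
   nothing is known where [F1] has no derivative. *)
Lemma ge0_integral_null (D N : set R) (f g : R -> \bar R) :
  measurable D -> measurable N -> mu N = 0%E ->
  (forall x, D x -> 0 <= f x)%E -> (forall x, D x -> 0 <= g x)%E ->
  (forall x, D x -> ~ N x -> f x = g x) ->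
  (\int[mu]_(x in D) f x <= \int[mu]_(x in D) g x)%E.
Proof.
move=> mD mN N0 f0 g0 fg; rewrite !ge0_integralE //.
apply: ge_ereal_sup => _ [h hf <-].
(* A simple function below [f] is zeroed on [N]: its integral is unchanged and it now lies below
   [g], so the suprema over simple functions compare directly. *)
have mNc : measurable (~` N) by exact: measurableC.
pose h' := (proj_nnsfun h mNc).
have h'E x : h' x = if x \in ~` N then h x else 0 by rewrite /h' -mrestrict patchE.
have -> : sintegral mu h = sintegral mu h'.
  rewrite -!integralT_nnsfun.
  apply: ge0_ae_eq_integral => //.
  - exact/measurable_EFinP.
  - exact/measurable_EFinP.
  - by move=> x _; rewrite lee_fin.
  - by move=> x _; rewrite lee_fin.
  - exists N; split=> // x /not_implyP[_] hx; apply: contrapT => Nx.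
    by apply: hx; rewrite h'E mem_set.
apply: ereal_sup_ubound; exists h' => // x; have := hf x.
rewrite h'E.
have [Nx|Nx] := pselect (N x).
  rewrite memNset; last by move=> /(_ Nx).
  move=> _; rewrite patchE; case: ifPn => // /set_mem; exact: g0.
rewrite mem_set// !patchE; case: ifPn => // /set_mem Dx.
by rewrite fg.
Qed.

(** Inversion is written through [powR] with exponent -1 on each side of 0; at 0 both conventions
    give 0. *)
Lemma measurable_inv : measurable_fun setT (@GRing.inv R).
Proof.
rewrite (_ : @GRing.inv R =
    fun x => if (x < 0)%R then - ((- x) `^ (-1)) else x `^ (-1)); last first.
  apply/funext => x; have [x0|x0] := ltP x 0; last by rewrite powR_inv1.
  by rewrite powR_inv1 ?oppr_ge0 ?ltW// invrN opprK.
apply: measurable_fun_ifT; first exact: measurable_fun_ltr.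
  apply: measurableT_comp => //.
  exact: (measurableT_comp (measurable_powR (-1))).
exact: measurable_powR.
Qed.

Lemma integral_null_eq (D N : set R) (f g : R -> \bar R) :
  measurable D -> measurable N -> mu N = 0%E ->
  (forall x, D x -> ~ N x -> f x = g x) ->
  (\int[mu]_(x in D) f x = \int[mu]_(x in D) g x)%E.
Proof.
move=> mD mN N0 fg; rewrite [LHS]integralE [RHS]integralE.
congr (_ - _)%E; apply/eqP; rewrite eq_le; apply/andP; split;
  by apply: (ge0_integral_null mD mN N0) => // x Dx Nx;
     rewrite ?funeposE ?funenegE fg.
Qed.

Lemma Rintegral_eq0 (D : set R) (f : R -> R) :
  (forall x, D x -> f x = 0) -> \int[mu]_(x in D) f x = 0.
Proof. by move=> f0; rewrite /Rintegral integral0_eq// => x Dx; rewrite f0. Qed.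

Lemma Rintegral_lt (a b : R) (f g : R -> R) : a < b ->
  mu.-integrable `[a, b] (EFin \o f) -> mu.-integrable `[a, b] (EFin \o g) ->
  (forall x, a < x < b -> f x < g x) ->
  \int[mu]_(x in `[a, b]) f x < \int[mu]_(x in `[a, b]) g x.
Proof.
move=> ab intf intg fg; rewrite -subr_gt0 -RintegralB//.
have intfg : mu.-integrable `[a, b] (EFin \o (fun x => g x - f x)).
  by have := integrableB _ intg intf => /(_ (measurable_itv _)).
have intfg' : mu.-integrable `]a, b[ (EFin \o (fun x => g x - f x)).
  by apply: integrableS intfg => //; apply: subset_itvScc; rewrite bnd_simp.
rewrite -Rintegral_itv_obnd_cbnd -?Rintegral_itv_bndo_bndc//; last first.
  by apply: integrableS intfg => //; apply: subset_itvScc; rewrite bnd_simp.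
rewrite -lte_fin fineK; last exact: integrable_fin_num.
apply: integral_gt0 => //.
- by rewrite lebesgue_measure_itv/= lte_fin ab -EFinB lte_fin subr_gt0.
- by apply/measurable_EFinP; exact: measurable_int intfg'.
- by move=> x; rewrite /= in_itv /= subr_gt0; exact: fg.
Qed.

End IntegralExtras.

(** * Change of variables along a distribution function *)

(** [f] is a nonnegative version of the density on the whole line, possibly vanishing at 0. [F] is
    tied to [f] on [[0, 1]] only, hence the separate measurability clause. *)
Definition cdf_density (R : realType) (F f : R -> R) : Prop :=
  [/\ measurable_fun setT f, forall x, 0 <= f x, forall x, 0 < x <= 1 -> 0 < f x,
      forall x, 0 <= x <= 1 ->
        (F x)%:E = (\int[lebesgue_measure]_(t in `[0%R, x]) (f t)%:E)%E &
      measurable_fun setT F /\ F 1 = 1].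

Section Density.
Variables (R : realType) (F f : R -> R).
Hypothesis Ff : cdf_density F f.
Notation mu := (@lebesgue_measure R).
Implicit Types (a b x : R) (P Q : {poly R}).

Let mf : measurable_fun setT f. Proof. by case: Ff. Qed.
Let f_ge0 x : 0 <= f x. Proof. by case: Ff. Qed.
Let FE x : 0 <= x <= 1 -> (F x)%:E = (\int[mu]_(t in `[0%R, x]) (f t)%:E)%E.
Proof. by case: Ff => _ _ _ + _; exact. Qed.

Lemma cdf_density_measurable : measurable_fun setT F. Proof. by case: Ff => _ _ _ _ []. Qed.

Lemma cdf1 : F 1 = 1. Proof. by case: Ff => _ _ _ _ []. Qed.

Lemma integrable_density : mu.-integrable `[0, 1] (EFin \o f).
Proof.
apply/integrableP; split; first by apply/measurable_EFinP; exact: measurable_funTS.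
under eq_integral do rewrite /= ger0_norm//.
by rewrite -FE ?ltry// ler01 lexx.
Qed.

Lemma integrable_density_mul (h : R -> R) (M : R) a b : 0 <= a -> b <= 1 ->
  measurable_fun setT h -> (forall x, a <= x <= b -> `|h x| <= M) ->
  mu.-integrable `[a, b] (EFin \o (fun x => h x * f x)).
Proof.
move=> a0 b1 mh hM; apply: (@integrable_bounded_mul _ _ _ _ M) => //.
  exact: measurable_funTS.
by apply: integrableS integrable_density => //; apply: subset_itvScc; rewrite bnd_simp.
Qed.

Lemma cdf_Rint x : 0 <= x <= 1 -> F x = \int[mu]_(t in `[0, x]) f t.
Proof. by move=> x01; rewrite /Rintegral -FE. Qed.

Lemma cdf0 : F 0 = 0.
Proof. by rewrite cdf_Rint ?lexx ?ler01// set_itv1 Rintegral_set1. Qed.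

Lemma cdf_incr a b : 0 <= a -> a <= b -> b <= 1 ->
  F b - F a = \int[mu]_(t in `]a, b]) f t.
Proof.
move=> a0 ab b1; rewrite !cdf_Rint; [|lra|lra].
apply: Rintegral_itvB; rewrite ?bnd_simp//.
by apply: integrableS integrable_density => //; apply: subset_itvScc; rewrite bnd_simp.
Qed.

Lemma cdf_le a b : 0 <= a -> a <= b -> b <= 1 -> F a <= F b.
Proof.
move=> a0 ab b1; rewrite -subr_ge0 cdf_incr//.
exact: Rintegral_ge0.
Qed.

Lemma cdf_itv x : 0 <= x <= 1 -> 0 <= F x <= 1.
Proof. by move=> /andP[x0 x1]; rewrite -{1}cdf0 -cdf1 !cdf_le. Qed.

Lemma cdf_lt a b : 0 <= a -> a < b -> b <= 1 -> F a < F b.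
Proof.
move=> a0 ab b1; rewrite -subr_gt0 cdf_incr// ?ltW// -lte_fin fineK; last first.
  apply: integrable_fin_num => //=.
  by apply: integrableS integrable_density => //; apply: subset_itvScc; rewrite bnd_simp.
apply: integral_gt0 => //=.
- by rewrite lebesgue_measure_itv/= lte_fin ab -EFinB lte_fin subr_gt0.
- exact: measurable_funTS.
- move=> x; rewrite in_itv => /andP[ax xb]; case: Ff => _ _ f0 _ _; apply: f0.
  by rewrite (le_lt_trans a0 ax) (le_trans xb b1).
Qed.

Lemma cdf_continuous : {within `[0, 1], continuous F}.
Proof.
have := @parameterized_integral_continuous R 0 1 f ler01 integrable_density.
apply: subspace_eq_continuous => x; rewrite inE /= in_itv => x01.
by rewrite /from_subspace /parameterized_integral -cdf_Rint.
Qed.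

Lemma cdf_midpoint a b : 0 <= a -> a <= b -> b <= 1 ->
  exists2 c, a <= c <= b & F c = (F a + F b) / 2.
Proof.
move=> a0 ab b1; have Fab := cdf_le a0 ab b1.
have [||c] := @IVT R F a b ((F a + F b) / 2) ab.
- apply: continuous_subspaceW cdf_continuous; by apply: subset_itvScc; rewrite bnd_simp.
- by rewrite min_l// max_r//; apply/andP; split; lra.
- by rewrite in_itv => cab; exists c.
Qed.

(* Cutting [a, b] into [2 ^ n] pieces of equal [F]-mass divides the bound by
   [2 ^ n]. *)
Lemma constant_of_quadratic_variation (e : R -> R) (L : R) :
  (forall a b, 0 <= a -> a <= b -> b <= 1 -> `|e b - e a| <= L * (F b - F a) ^+ 2) ->
  forall x, 0 <= x <= 1 -> e x = e 0.
Proof.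
move=> eL x /andP[x0 x1].
have halved n a b : 0 <= a -> a <= b -> b <= 1 ->
    `|e b - e a| <= L * (F b - F a) ^+ 2 / 2 ^+ n.
  elim: n a b => [|n IH] a b a0 ab b1; first by rewrite expr0 divr1 eL.
  have [c /andP[ac cb] Fc] := cdf_midpoint a0 ab b1.
  rewrite -(subrK (e c) (e b)) -addrA (le_trans (ler_normD _ _))//.
  have /IH := le_trans a0 ac => /(_ _ cb b1) h1.
  have h2 := IH _ _ a0 ac (le_trans cb b1).
  apply: le_trans (lerD h1 h2) _; rewrite Fc [2 ^+ n.+1]exprS.
  by rewrite le_eqVlt; apply/orP; left; apply/eqP; field; rewrite expf_neq0.
apply/eqP; rewrite -subr_eq0 -normr_le0; apply/ler_addgt0Pl => d d0.
have [n Hn] : exists n, L * (F x - F 0) ^+ 2 / 2 ^+ n <= d.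
  exists (Num.truncn (L * (F x - F 0) ^+ 2 / d)).+1.
  set K := L * _; set n := Num.truncn _.
  rewrite ler_pdivrMr ?exprn_gt0//.
  have h : K / d < n.+1%:R by exact: truncnS_gt.
  move: h; rewrite ltr_pdivrMr// => /ltW /le_trans -> //.
  by rewrite mulrC ler_wpM2l ?(ltW d0)// -natrX ler_nat ltnW// ltn_expl.
by rewrite addr0 (le_trans _ Hn)// halved.
Qed.

Lemma integrable_poly_density P a b : 0 <= a -> b <= 1 ->
  mu.-integrable `[a, b] (EFin \o (fun t => P.[F t] * f t)).
Proof.
move=> a0 b1; have [M PM] := poly_bounded P.
apply: (@integrable_density_mul (fun t => P.[F t]) M) => //.
  apply: measurableT_comp cdf_density_measurable; exact: measurable_horner.
by move=> x /andP[ax xb]; rewrite PM// cdf_itv// (le_trans a0)// (le_trans xb).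
Qed.

(** Change of variable [u = F t], where [F] may fail to be differentiable. On [[a, b]] both the
    integral and the increment of [Q] along [F] equal [P.[F a] * (F b - F a)] up to
    [O((F b - F a) ^ 2)], so their difference [e] is constant by
    [constant_of_quadratic_variation]. *)
Lemma integral_poly_density P Q x : Q^`() = P -> Q.[0] = 0 -> 0 <= x <= 1 ->
  \int[mu]_(t in `[0, x]) (P.[F t] * f t) = Q.[F x].
Proof.
move=> QP Q0 x01.
pose e x := \int[mu]_(t in `[0, x]) (P.[F t] * f t) - Q.[F x].
suff : e x = e 0.
  by rewrite /e cdf0 Q0 set_itv1 Rintegral_set1 subrr => /eqP; rewrite subr_eq0 => /eqP.
have [L1 L10 PL] := poly_lipschitz P; have [L2 L20 QL] := poly_taylor1 Q.
apply: (@constant_of_quadratic_variation e (L1 + L2)) x01 => a b a0 ab b1.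
have Fa := cdf_itv (_ : 0 <= a <= 1); have {Fa}Fa : 0 <= F a <= 1 by apply: Fa; lra.
have Fb := cdf_itv (_ : 0 <= b <= 1); have {Fb}Fb : 0 <= F b <= 1 by apply: Fb; lra.
have sub : `]a, b] `<=` `[a, b] by apply: subset_itvScc; rewrite bnd_simp.
have intP P' : mu.-integrable `]a, b] (EFin \o (fun t => P'.[F t] * f t)).
  by apply: integrableS (integrable_poly_density P' a0 b1).
have -> : e b - e a = \int[mu]_(t in `]a, b]) ((P - (P.[F a])%:P).[F t] * f t)
    - (Q.[F b] - Q.[F a] - P.[F a] * (F b - F a)).
  have -> : \int[mu]_(t in `]a, b]) ((P - (P.[F a])%:P).[F t] * f t) =
      \int[mu]_(t in `]a, b]) (P.[F t] * f t) - P.[F a] * (F b - F a).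
    rewrite cdf_incr// -RintegralZl//; last first.
      by have := intP 1; apply: eq_integrable => // t _ /=; rewrite hornerE mul1r.
    rewrite -RintegralB//; last first.
      by have := intP P.[F a]%:P; apply: eq_integrable => // t _ /=; rewrite hornerC.
    by apply: eq_Rintegral => t _; rewrite !hornerE mulrBl.
  rewrite -(Rintegral_itvB (integrable_poly_density P (lexx 0) b1)) ?bnd_simp//.
  by rewrite /e; ring.
rewrite (le_trans (ler_normB _ _))// mulrDl lerD//; last by rewrite -QP QL.
rewrite (le_trans (le_normr_Rintegral _ _))//.
apply: (@le_trans _ _ (\int[mu]_(t in `]a, b]) (L1 * (F b - F a) * f t))).
  apply: le_Rintegral => //.
  - have := integrable_norm (intP (P - (P.[F a])%:P)); exact.
  - have := intP (L1 * (F b - F a))%:P.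
    by apply: eq_integrable => // t _ /=; rewrite hornerC.
  - move=> t; rewrite /= in_itv /= => /andP[/ltW at_ tb].
    rewrite normrM (ger0_norm (f_ge0 t)) ler_wpM2r// !hornerE.
    have Ft : 0 <= F t <= 1 by apply: cdf_itv; lra.
    rewrite (le_trans (PL _ _ Fa Ft))// ler_wpM2l//.
    have Fat : F a <= F t by apply: cdf_le => //; lra.
    by rewrite ger0_norm ?subr_ge0// lerD2r cdf_le//; lra.
rewrite RintegralZl//; last first.
  by have := intP 1; apply: eq_integrable => // t _ /=; rewrite hornerE mul1r.
by rewrite -cdf_incr// expr2 mulrA.
Qed.

End Density.

(** * Exchange of two integrals against a bounded kernel *)

Section Fubini.
Variable R : realType.
Notation mu := (@lebesgue_measure R).
Variables (D : set R) (f g : R -> R) (K : R -> R -> R) (M : R).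
Hypotheses (mD : measurable D) (intf : mu.-integrable D (EFin \o f))
  (intg : mu.-integrable D (EFin \o g))
  (mK : measurable_fun setT (fun z : R * R => K z.1 z.2))
  (KM : forall x y, D x -> D y -> `|K x y| <= M).

Let fD := f \_ D.
Let gD := g \_ D.

Let mfD : measurable_fun setT fD.
Proof.
apply/(measurable_restrictT _ _).1 => //.
by apply/measurable_EFinP; exact: measurable_int intf.
Qed.

Let mgD : measurable_fun setT gD.
Proof.
apply/(measurable_restrictT _ _).1 => //.
by apply/measurable_EFinP; exact: measurable_int intg.
Qed.

Let integrable_patch (u : R -> R) : mu.-integrable D (EFin \o u) ->
  mu.-integrable setT (EFin \o (u \_ D)).
Proof.
by move=> iu; rewrite -restrict_EFin; apply/integrable_restrict => //=; rewrite setTI.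
Qed.

Let integrable_dom :
  (mu \x mu)%E.-integrable setT (fun z => (M * (fD z.1 * gD z.2))%:E).
Proof.
apply/integrable12ltyP.
  apply/measurable_EFinP; apply: measurable_funM => //; apply: measurable_funM.
    exact: measurableT_comp.
  exact: measurableT_comp.
have h x : (\int[mu]_y `|(M * (fD x * gD y))%:E| =
    (`|M| * `|fD x| * \int[mu]_y `|gD y|)%:E)%E.
  under eq_integral do rewrite /= !normrM mulrA EFinM.
  rewrite integralZl//; last exact: (integrable_norm (integrable_patch intg)).
  rewrite [RHS]EFinM /Rintegral fineK//; apply: integrable_fin_num => //.
  exact: (integrable_norm (integrable_patch intg)).
under eq_integral do rewrite /= h.
set I := \int[mu]_y `|gD y|.
have -> : (\int[mu]_x (`|M| * `|fD x| * I)%:E = \int[mu]_x ((`|M| * I)%:E * `|fD x|%:E))%E.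
  by apply: eq_integral => x _; rewrite mulrAC EFinM.
rewrite integralZl//; last exact: (integrable_norm (integrable_patch intf)).
apply: lte_mul_pinfty => //.
  by rewrite lee_fin mulr_ge0// Rintegral_ge0.
exact: (integrable_lty _ (integrable_norm (integrable_patch intf))).
Qed.

Let G (z : R * R) := (fD z.1 * (gD z.2 * K z.1 z.2))%:E.

Let integrable_G : (mu \x mu)%E.-integrable setT G.
Proof.
apply: le_integrable integrable_dom => //.
  apply/measurable_EFinP; apply: measurable_funM; first exact: measurableT_comp.
  by apply: measurable_funM => //; exact: measurableT_comp.
move=> [x y] _; rewrite /G /fD /gD /= !patchE lee_fin.
have [Dx|] := boolP (x \in D); last by rewrite !mul0r mulr0.
have [Dy|] := boolP (y \in D); last by rewrite !(mul0r, mulr0).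
rewrite !normrM mulrA mulrC ler_wpM2r// (le_trans (KM _ _))// ?ler_norm//; exact: set_mem.
Qed.

(** The integrand [G] on the plane is dominated by the integrable product of [f], [g] and the bound
    [M]. The outer integral stays in the extended reals, the shape to which [cube_integral]
    unfolds. *)
Lemma Rintegral_exchange :
  (\int[mu]_(x in D) ((\int[mu]_(y in D) (g y * K x y))%R * f x)%:E =
   (\int[mu]_(y in D) (g y * \int[mu]_(x in D) (K x y * f x)))%R%:E)%E.
Proof.
have mK1 x : measurable_fun setT (K x).
  by have := measurableT_comp mK (measurable_pair1 x).
have mK2 y : measurable_fun setT (K^~ y).
  by have := measurableT_comp mK (measurable_pair2 y).
have E1 x : (\int[mu]_y G (x, y) =
    ((fun x => (\int[mu]_(y in D) (g y * K x y)) * f x) \_ D x)%:E)%E.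
  rewrite patchE /G /fD /= patchE; have [/set_mem Dx|_] := boolP (x \in D); last first.
    by under eq_integral do rewrite mul0r; rewrite integral0.
  have ig : mu.-integrable D (EFin \o (fun y => g y * K x y)).
    under [_ \o _]eq_fun do rewrite mulrC.
    apply: (@integrable_bounded_mul _ _ _ _ M) => //; first exact: measurable_funTS.
    by move=> y Dy; exact: KM.
  rewrite mulrC EFinM /Rintegral fineK; last exact: integrable_fin_num.
  rewrite -integralZl// [RHS]integral_mkcond; apply: eq_integral => y _.
  by rewrite /gD !patchE; case: ifPn => _; rewrite ?mul0r ?mulr0.
have E2 y : (\int[mu]_x G (x, y) =
    ((fun y => g y * \int[mu]_(x in D) (K x y * f x)) \_ D y)%:E)%E.
  rewrite patchE /G /gD /= patchE; have [/set_mem Dy|_] := boolP (y \in D); last first.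
    by under eq_integral do rewrite mul0r mulr0; rewrite integral0.
  have ig : mu.-integrable D (EFin \o (fun x => K x y * f x)).
    apply: (@integrable_bounded_mul _ _ _ _ M) => //; first exact: measurable_funTS.
    by move=> x Dx; exact: KM.
  rewrite EFinM /Rintegral fineK; last exact: integrable_fin_num.
  rewrite -integralZl// [RHS]integral_mkcond; apply: eq_integral => x _.
  rewrite /fD !patchE; case: ifPn => _; rewrite ?mul0r ?mulr0//= -EFinM; congr EFin; ring.
have := Fubini integrable_G.
under eq_integral do rewrite E1.
under [in RHS]eq_integral do rewrite E2.
move=> FubG.
rewrite integral_mkcond /Rintegral [in RHS]integral_mkcond.
transitivity (\int[mu]_x
   (((fun x => (\int[mu]_(y in D) (g y * K x y)) * f x) \_ D x)%:E))%E.
  by apply: eq_integral => x _; rewrite !patchE; case: ifP.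
rewrite FubG fineK; first by apply: eq_integral => x _; rewrite !patchE; case: ifP.
have : (\int[mu]_y fubini_G mu G y \is a fin_num)%E.
  by rewrite (integral21_prod_meas1 integrable_G); exact: integrable_fin_num.
congr (_ \is a fin_num); apply: eq_integral => y _; rewrite /fubini_G E2.
by rewrite !patchE; case: ifP.
Qed.

End Fubini.

(** * Iterated integrals of the minimum and the maximum *)

Lemma measurable_phi d (T : measurableType d) (R : realType) (p k : nat) (u v : T -> R) :
  measurable_fun setT u -> measurable_fun setT v ->
  measurable_fun setT (fun z => (phi p k (u z)).[v z]).
Proof.
move=> mu mv; under eq_fun do rewrite hornerphi horner_bsum.
apply: measurable_funM => //; apply: measurable_funB; first exact: measurable_funX.
apply: measurable_sum => j; apply: measurable_funM => //.
apply: measurable_funM; apply: measurable_funX => //.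
exact: measurable_funB.
Qed.

Section MinRecursion.
Variables (R : realType) (F f : R -> R).
Hypothesis Ff : cdf_density F f.
Notation mu := (@lebesgue_measure R).
Implicit Types (p k : nat) (a c r s t x : R).

Let mF := cdf_density_measurable Ff.

Lemma min_itv r x : 0 <= r <= 1 -> 0 <= x <= 1 -> 0 <= Num.min r x <= 1.
Proof. by move=> /andP[r0 r1] /andP[x0 x1]; rewrite le_min r0 x0 ge_min r1. Qed.

Lemma max_itv r x : 0 <= r <= 1 -> 0 <= x <= 1 -> 0 <= Num.max r x <= 1.
Proof. by move=> /andP[r0 r1] /andP[x0 x1]; rewrite ge_max r1 x1 le_max r0. Qed.

Lemma phi_min_itv p k r x : 0 <= r <= 1 -> 0 <= x <= 1 ->
  0 <= (phi p k (F x)).[F (Num.min r x)] <= 1.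
Proof.
move=> r01 x01; have /andP[x0 x1] := x01; have /andP[m0 m1] := min_itv r01 x01.
apply: phi_itv.
- by have /andP[] := cdf_itv Ff (min_itv r01 x01).
- by apply: (cdf_le Ff) => //; rewrite ge_min lexx orbT.
- by have /andP[] := cdf_itv Ff x01.
Qed.

Let measurable_min r : measurable_fun setT (fun t : R => F (Num.min r t)).
Proof. by apply: measurableT_comp mF _; exact: measurable_minr. Qed.

Lemma integrable_phi p k r x : 0 <= r <= 1 -> 0 <= x <= 1 ->
  mu.-integrable `[0, x] (EFin \o (fun t => (phi p k (F x)).[F (Num.min r t)] * f t)).
Proof.
move=> r01 x01; have /andP[x0 x1] := x01.
apply: (integrable_density_mul Ff (M := 1)) => //; first exact: measurable_phi.
move=> t /andP[t0 tx].
suff /andP[h0 h1] : 0 <= (phi p k (F x)).[F (Num.min r t)] <= 1 by rewrite ger0_norm.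
have -> : Num.min r t = Num.min (Num.min r t) x by rewrite -minA (min_l tx).
by apply: phi_min_itv => //; apply: min_itv; rewrite ?t0 ?(le_trans tx).
Qed.

(** The recursion in the number of variables. The integral is cut at [m]: below it the minimum is
    [t] and [deriv_phiS] gives the primitive [Q]; above it the minimum is constantly [m]. *)
Lemma Rintegral_phi p k r x : 0 <= r <= 1 -> 0 <= x <= 1 ->
  \int[mu]_(t in `[0, x]) ((phi p k (F x)).[F (Num.min r t)] * f t) =
  (phi p k.+1 (F x)).[F (Num.min r x)].
Proof.
move=> r01 x01; have /andP[x0 x1] := x01; have /andP[r0 r1] := r01.
set y := F x; set m := Num.min r x.
have m01 : 0 <= m <= 1 by exact: min_itv.
have [m0 m1] := andP m01.
have mx : m <= x by rewrite ge_min lexx orbT.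
pose Q := phi p k.+1 y - (y%:P - 'X) * phi p k y.
have Q0 : Q.[0] = 0.
  rewrite /Q hornerD hornerN hornerM hornerD hornerN hornerC hornerX subr0 !phi_at0.
  by case: (p) => [|?]; rewrite ?exprS ?mulr0 subrr.
have int1 : \int[mu]_(t in `[0, m]) ((phi p k y).[F (Num.min r t)] * f t) = Q.[F m].
  rewrite -(integral_poly_density Ff (deriv_phiS p k y) Q0 m01).
  apply: eq_Rintegral => t; rewrite inE /= in_itv /= => /andP[t0 tm].
  by rewrite min_r// (le_trans tm)// ge_min lexx.
have int2 : \int[mu]_(t in `]m, x]) ((phi p k y).[F (Num.min r t)] * f t) =
    (phi p k y).[F m] * (F x - F m).
  rewrite (cdf_incr Ff)// -RintegralZl//.
    apply: eq_Rintegral => t; rewrite inE /= in_itv /= => /andP[mt tx].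
    congr ((phi p k y).[F _] * _); rewrite /m; move: mt; rewrite /m.
    by case: (leP r x) => [rx rt|xr xt]; [rewrite min_l// ltW|lra].
  apply: integrableS (integrable_density Ff) => //.
  by apply: subset_itvScc; rewrite bnd_simp.
have := Rintegral_itvB (integrable_phi p k r01 x01) (x := m).
rewrite !bnd_simp => /(_ m0 mx) /eqP; rewrite subr_eq => /eqP ->.
rewrite int1 int2 /Q hornerD hornerN hornerM hornerD hornerN hornerC hornerX -/y; ring.
Qed.

Variable g : R -> R.
Hypothesis gf : forall x, 0 < x <= 1 -> g x = f x.

(** The given version [g] of the density and its nonnegative version [f] differ on [[0, x]] at most
    at 0, a null set. *)
Lemma integral_version (D : R -> R) x : x <= 1 ->
  (\int[mu]_(t in `[0%R, x]) (D t * g t)%:E = \int[mu]_(t in `[0%R, x]) (D t * f t)%:E)%E.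
Proof.
move=> x1; apply: (@integral_null_eq _ _ [set 0]) => //; first exact: lebesgue_measure_set1.
move=> t /=; rewrite in_itv /= => /andP[t0 tx] /eqP tN0; congr (_ * _)%:E.
by rewrite gf// lt_neqAle eq_sym tN0 t0 (le_trans tx).
Qed.

(** Induction on [k], general in [c] and [r]: the first coordinate [t] is absorbed into [c * g t]
    and [min r t], then integrated out by [Rintegral_phi]. For [k = 0] the minimum of the empty
    profile is 1, so the left side sees [F r]; this is where [r <= a] enters. *)
Lemma cube_integral_min p k a c r : 0 <= a <= 1 -> 0 <= r <= 1 ->
  (0 < k)%N || (r <= a) ->
  cube_integral k a
    (fun w => c * F (Num.min r (minval w)) ^+ p * \prod_(x <- w) g x) =
  (c * (phi p k (F a)).[F (Num.min r a)])%:E.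
Proof.
move=> a01; have /andP[a0 a1] := a01.
elim: k c r => [|k IH] c r r01 /=.
  move=> ra; rewrite /minval !big_nil phi0 mulr1 min_l ?(min_l ra)//.
  by case/andP: r01.
move=> _.
transitivity (\int[mu]_(t in `[0%R, a])
    (c * (phi p k (F a)).[F (Num.min r t)] * g t)%:E)%E.
  apply: eq_integral => t; rewrite inE /= in_itv /= => /andP[t0 ta].
  have t01 : 0 <= t <= 1 by rewrite t0 (le_trans ta).
  rewrite (_ : (fun w => _) = (fun w => c * g t *
      F (Num.min (Num.min r t) (minval w)) ^+ p * \prod_(x <- w) g x)).
    rewrite IH ?min_itv// ?ge_min ?ta ?orbT//.
    by rewrite -minA (min_l ta) mulrAC.
  by apply/funext => w; rewrite /minval !big_cons minA; ring.
rewrite integral_version// -Rintegral_phi//.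
rewrite -RintegralZl//; last exact: integrable_phi.
rewrite /Rintegral fineK.
  by apply: eq_integral => t _; rewrite mulrA.
apply: integrable_fin_num => //.
exact: (integrableZl _ _ (integrable_phi _ _ _ _)).
Qed.

Variable xi : R -> R.
Hypothesis intxi : mu.-integrable `[0, 1] (EFin \o xi).

(* The expectation of [F (min r V_1 .. V_k) ^ p] on the event
   [max s V_1 .. V_k > x], for [V_1, .., V_k] independent of law [F]. *)
Let kernel p k r s x : R :=
  (phi p k 1).[F r] - (s < x)%R%:R * (phi p k (F x)).[F (Num.min r x)].

Let cdf_one : F 1 = 1 := cdf1 Ff.

Let phi1_itv p k r : 0 <= r <= 1 -> 0 <= (phi p k 1).[F r] <= 1.
Proof.
move=> r01; have := phi_min_itv p k r01 (_ : 0 <= 1 <= 1).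
by rewrite cdf_one min_l ?ler01 ?lexx //; [exact|case/andP: r01].
Qed.

Let kernel_bounded p k r s x : 0 <= r <= 1 -> 0 <= x <= 1 -> `|kernel p k r s x| <= 1.
Proof.
move=> r01 x01; rewrite /kernel.
have := phi_min_itv p k r01 x01; have := phi1_itv p k r01.
case: (s < x) => /andP[? ?] /andP[? ?]; rewrite ?mul1r ?mul0r; rewrite ler_norml; lra.
Qed.

Let measurable_kernel p k r s :
  measurable_fun setT
    (fun z : R * R => kernel p k (Num.min r z.1) (Num.max s z.1) z.2).
Proof.
rewrite /kernel; apply: measurable_funB.
  apply: measurable_phi => //.
  apply: measurableT_comp mF _; apply: measurable_minr => //.
apply: measurable_funM.
  apply: (@measurableT_comp _ _ _ _ _ _ (fun b : bool => b%:R : R)) => //.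
  by apply: measurable_fun_ltr => //; apply: measurable_maxr.
apply: measurable_phi; first exact: measurableT_comp.
apply: measurableT_comp mF _; apply: measurable_minr => //.
exact: measurable_minr.
Qed.

(** The event [max s t < x] splits into [s < x] and [t < x], so the subtracted part is an integral
    over [[0, x]], given by [Rintegral_phi]. *)
Let kernel_step p k r s x : 0 <= r <= 1 -> 0 <= x <= 1 ->
  \int[mu]_(t in `[0, 1]) (kernel p k (Num.min r t) (Num.max s t) x * f t) =
  kernel p k.+1 r s x.
Proof.
move=> r01 x01; have /andP[x0 x1] := x01; have o01 : 0 <= (1:R) <= 1 by rewrite ler01 lexx.
pose u t := (t < x)%R%:R * (phi p k (F x)).[F (Num.min (Num.min r t) x)].
have mind : measurable_fun setT (fun t : R => (t < x)%R%:R : R).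
  apply: (@measurableT_comp _ _ _ _ _ _ (fun b : bool => b%:R : R)) => //.
  exact: measurable_fun_ltr.
have mu_ : measurable_fun setT u.
  apply: measurable_funM => //; apply: measurable_phi => //.
  by apply: measurableT_comp mF _; apply: measurable_minr => //; exact: measurable_minr.
have intu : mu.-integrable `[0, 1] (EFin \o (fun t => u t * f t)).
  apply: (integrable_density_mul Ff (M := 1)) => // t t01.
  have /andP[? ?] := phi_min_itv p k (min_itv r01 t01) x01.
  by rewrite /u; case: (t < x); rewrite ?mul1r ?mul0r ?normr0 ?ler01// ger0_norm.
have Iu : \int[mu]_(t in `[0, 1]) (u t * f t) = (phi p k.+1 (F x)).[F (Num.min r x)].
  have := Rintegral_itvB intu (x := x).
  rewrite !bnd_simp => /(_ x0 x1) /eqP; rewrite subr_eq => /eqP ->.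
  rewrite (_ : \int[mu]_(t in `]x, 1]) _ = 0) ?add0r; last first.
    apply: Rintegral_eq0 => t.
    by rewrite /= in_itv /= /u => /andP[xt _]; rewrite ltNge (ltW xt) !mul0r.
  rewrite -Rintegral_phi// -!Rintegral_itv_bndo_bndc//.
  - apply: eq_Rintegral => t; rewrite inE /= in_itv /= /u => /andP[_ tx].
    by rewrite tx mul1r -minA (min_l (ltW tx)).
  - apply: integrableS (integrable_phi p k r01 x01) => //.
    by apply: subset_itvScc; rewrite bnd_simp.
  - by apply: integrableS intu => //; apply: subset_itvScc; rewrite bnd_simp.
have i1 : mu.-integrable `[0, 1] (EFin \o (fun t => (phi p k 1).[F (Num.min r t)] * f t)).
  by have := integrable_phi p k r01 o01; rewrite cdf_one.
transitivity (\int[mu]_(t in `[0, 1]) ((phi p k 1).[F (Num.min r t)] * f t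
    - (s < x)%R%:R * (u t * f t))).
  apply: eq_Rintegral => t _; rewrite /kernel /u gt_max.
  by case: (s < x); case: (t < x); rewrite /= ?mul0r ?mul1r; ring.
rewrite RintegralB//; last exact: (integrableZl _ _ intu).
have := Rintegral_phi p k r01 o01; rewrite cdf_one => ->.
by rewrite RintegralZl// Iu min_l//; case/andP: r01.
Qed.

Let sig x := \int[mu]_(t in `[0, x]) xi t.

Let integrable_xi_kernel p k r s : 0 <= r <= 1 ->
  mu.-integrable `[0, 1] (EFin \o (fun x => xi x * kernel p k r s x)).
Proof.
move=> r01; under [_ \o _]eq_fun do rewrite mulrC.
apply: (integrable_bounded_mul (M := 1)) => //; last first.
  by move=> x /=; rewrite in_itv; exact: kernel_bounded.
apply: measurable_funTS.
apply: measurable_funB => //; apply: measurable_funM.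
  apply: (@measurableT_comp _ _ _ _ _ _ (fun b : bool => b%:R : R)) => //.
  by apply: measurable_fun_ltr.
by apply: measurable_phi.
Qed.

(** Integration by parts in expectation: the bid [sig] at the maximum integrates its rate [xi x]
    over all [x] up to the maximum, and averaging that indicator over the variables leaves [kernel],
    with one exchange of integrals per variable. For [k = 0], [r <= s] makes [kernel] vanish beyond
    [s]. *)
Lemma cube_integral_minmax p k c r s : 0 <= r <= 1 -> 0 <= s <= 1 ->
  (0 < k)%N || (r <= s) ->
  cube_integral k 1 (fun w => c * sig (Num.max s (maxval w)) *
    F (Num.min r (minval w)) ^+ p * \prod_(x <- w) g x) =
  (c * \int[mu]_(x in `[0, 1]) (xi x * kernel p k r s x))%:E.
Proof.
elim: k c r s => [|k IH] c r s r01 s01 /=.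
  move=> rs; have /andP[r0 r1] := r01; have /andP[s0 s1] := s01.
  rewrite /minval /maxval !big_nil mulr1 (min_l r1) (max_l s0).
  rewrite -mulrA; congr (_ * _)%:E.
  have := Rintegral_itvB (integrable_xi_kernel p 0 s r01) (x := s).
  rewrite !bnd_simp => /(_ s0 s1) /eqP; rewrite subr_eq => /eqP ->.
  rewrite (_ : \int[mu]_(t in `]s, 1]) _ = 0) ?add0r; last first.
    apply: Rintegral_eq0 => t.
    rewrite /= in_itv /= /kernel => /andP[st _].
    by rewrite st min_l ?(le_trans rs (ltW st))// !phi0 mul1r subrr mulr0.
  rewrite /sig mulrC -RintegralZl//; last first.
    by apply: integrableS intxi => //; apply: subset_itvScc; rewrite bnd_simp.
  apply: eq_Rintegral => t; rewrite inE /= in_itv /= /kernel => /andP[_ ts].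
  by rewrite ltNge ts mul0r subr0 phi0 mulrC.
move=> _.
have icxi : mu.-integrable `[0, 1] (EFin \o (fun x => c * xi x)).
  exact: (integrableZl _ _ intxi).
transitivity (\int[mu]_(t in `[0%R, 1%R])
    ((\int[mu]_(x in `[0, 1]) (c * xi x * kernel p k (Num.min r t) (Num.max s t) x))%R
      * g t)%:E)%E.
  apply: eq_integral => t; rewrite inE /= in_itv /= => t01.
  rewrite (_ : (fun w => _) = (fun w => c * g t *
      sig (Num.max (Num.max s t) (maxval w)) *
      F (Num.min (Num.min r t) (minval w)) ^+ p * \prod_(x <- w) g x)).
    rewrite IH ?min_itv ?max_itv//; last first.
      (* The side condition persists because [t] separates [min r t] from [max s t]. *)
      by apply/orP; right; rewrite ge_min !le_max lexx !orbT.
    congr EFin; rewrite -mulrA mulrCA [RHS]mulrC; congr (_ * _).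
    rewrite -RintegralZl//; first by apply: eq_Rintegral => x _; rewrite mulrA.
    by apply: integrable_xi_kernel; exact: min_itv.
  by apply/funext => w; rewrite /minval /maxval !big_cons minA maxA; ring.
rewrite integral_version//.
rewrite (Rintegral_exchange (M := 1)
   (K := fun t x => kernel p k (Num.min r t) (Num.max s t) x)) => //; last 2 first.
- exact: integrable_density Ff.
- by move=> t x /=; rewrite !in_itv /= => t01 x01; apply: kernel_bounded => //; exact: min_itv.
rewrite -RintegralZl//; last exact: integrable_xi_kernel.
congr EFin; apply: eq_Rintegral => x; rewrite inE /= in_itv /= => x01.
by rewrite kernel_step// mulrA.
Qed.

Lemma integrable_mul_oneB_cdfX n :
  mu.-integrable `[0, 1] (EFin \o (fun x => xi x * (1 - F x ^+ n))).
Proof.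
under [_ \o _]eq_fun do rewrite mulrC.
apply: (integrable_bounded_mul (M := 1)) => //.
  by apply/measurable_funTS/measurable_funB => //; exact: measurable_funX.
move=> x /=; rewrite in_itv => /(cdf_itv Ff)/andP[F0 F1].
have := exprn_ile1 n F0 F1; have := exprn_ge0 n F0.
by move=> ? ?; rewrite ler_norml; lra.
Qed.

Lemma cube_integral_max p k c : (0 < k)%N ->
  cube_integral k 1 (fun w => c * sig (maxval w) *
    F (minval w) ^+ p * \prod_(x <- w) g x) =
  (c / 'C(p + k, p)%:R * \int[mu]_(x in `[0, 1]) (xi x * (1 - F x ^+ (p + k))))%:E.
Proof.
move=> k0; have o01 : 0 <= (1:R) <= 1 by rewrite ler01 lexx.
have z01 : 0 <= (0:R) <= 1 by rewrite ler01 lexx.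
have max0 (w : seq R) : Num.max 0 (maxval w) = maxval w.
  apply: max_r; rewrite /maxval; elim: w => [|a w IH]; rewrite ?big_nil// big_cons.
  by rewrite le_max IH orbT.
have min1 (w : seq R) : Num.min 1 (minval w) = minval w.
  apply: min_r; rewrite /minval; elim: w => [|a w IH]; rewrite ?big_nil// big_cons.
  by rewrite ge_min IH orbT.
have := @cube_integral_minmax p k c 1 0 o01 z01; rewrite k0 => /(_ isT) h.
under eq_fun do rewrite -max0 -[minval _]min1.
rewrite h -mulrA; congr (_ * _)%:E.
rewrite -RintegralZl//; last exact: integrable_mul_oneB_cdfX.
apply: eq_Rintegral => x; rewrite inE /= in_itv /= => /andP[x0 x1].
rewrite mulrCA; congr (_ * _); rewrite /kernel cdf_one (min_r x1) !phi_diag expr1n mulr1.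
have [_|] := ltP 0 x; first by rewrite mul1r mulrBr mulr1.
(* At [x = 0] the indicator [0 < x] fails, but the missing term is [F 0 ^ (p + k) = 0] since
   [k > 0]. *)
move=> x_le0; have -> : x = 0 by apply/eqP; rewrite eq_le x0 x_le0.
by rewrite (cdf0 Ff) expr0n addn_eq0 (gtn_eqF k0) andbF mul0r !subr0 mulr1.
Qed.

End MinRecursion.

(** * Equilibrium bids and expected highest bid *)

(** The difference quotient of [e] is at most [L * |h| * q h ^ 2] in absolute value, where [q], the
    difference quotient of [F], converges. *)
Lemma is_derive_quadratic (R : realType) (F e : R -> R) (x l L : R) :
  is_derive x 1 F l -> e x = 0 ->
  (\forall y \near x, `|e y| <= L * (F y - F x) ^+ 2) ->
  is_derive x 1 e 0.
Proof.
move=> dF ex0 eL.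
have qF : h^-1 *: (F (h *: 1 + x) - F x) @[h --> 0^'] --> l.
  by have [/cvg_ex[l' Fl'] <-] := dF; rewrite /derive (cvg_lim _ Fl').
have idh : (h : R) @[h --> 0^'] --> (0 : R).
  by apply: cvg_within_filter; exact: cvg_id.
pose q h := h^-1 *: (F (h *: 1 + x) - F x).
have bound : (L * `|h|) * (q h * q h) @[h --> 0^'] --> (L * `|0 : R|) * (l * l).
  exact: (cvgM (cvgMl_tmp (cvg_norm idh)) (cvgM qF qF)).
rewrite normr0 mulr0 mul0r in bound.
have qe : h^-1 *: (e (h *: 1 + x) - e x) @[h --> 0^'] --> (0 : R).
  apply/cvgr0Pnorm_le => d d0.
  move/cvgr0Pnorm_le : bound => /(_ d d0) bound.
  have near_x : \forall h \near 0^', `|e (h *: 1 + x)| <= L * (F (h *: 1 + x) - F x) ^+ 2.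
    move/nbhs_ballP : eL => [r /= r0 eL]; near=> h.
    apply: eL; rewrite /ball /= [h *: 1]mulr1 opprD addrCA subrr addr0 normrN.
    by near: h; exact: dnbhs0_lt.
  near=> h.
  have h0 : h != 0 by near: h; exact: nbhs_dnbhs_neq.
  apply: (@le_trans _ _ `|L * `|h| * (q h * q h)|); last by near: h.
  rewrite ex0 subr0 normrZ normfV (le_trans _ (ler_norm _))// ler_pdivrMl ?normr_gt0//.
  have -> : `|h| * (L * `|h| * (q h * q h)) = L * (F (h *: 1 + x) - F x) ^+ 2.
    transitivity (L * (h ^+ 2 * (q h * q h))); first by rewrite -(real_normK (num_real h)); ring.
    by rewrite /q /GRing.scale /=; field.
  by near: h.
split; first by apply/cvg_ex; exists 0.
exact: cvg_lim.
Unshelve. all: by end_near. Qed.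

(** * Almost everywhere differentiation of the distribution function *)

Section DensityDerive.
Variables (R : realType) (F f : R -> R).
Hypothesis Ff : cdf_density F f.
Notation mu := (@lebesgue_measure R).

(** Lebesgue differentiation for [f] cut off outside [[0, 1]], whose primitive agrees with [F] near
    an interior point. *)
Lemma cdf_ae_derive :
  {ae mu, forall x : R, 0 < x < 1 -> is_derive x 1 F (f x)}.
Proof.
pose fD := f \_ `[0, 1]; have intf := integrable_density Ff.
have intfD : mu.-integrable setT (EFin \o fD).
  by rewrite -restrict_EFin; apply/integrable_restrict => //=; rewrite setTI.
have := @FTC1 R fD (BLeft 0) _ (integrable_locally _ intf).
have h y : mu.-integrable [set` Interval (BLeft 0) (BRight y)] (EFin \o fD).
  exact: integrableS intfD.
move=> /(_ h) => {}h.
have {}h := h (measurable_itv _).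
apply: filterS h; first exact: (ae_filter_ringOfSetsType mu).
move=> x /= hx x01; have /andP[x0 x1] := x01.
move: hx; rewrite lte_fin => /(_ x0)[dG G'].
have -> : f x = fD x by rewrite /fD patchE mem_set//= in_itv /= !ltW.
rewrite -G' derive1E.
apply: near_eq_is_derive; last exact: derivableP.
near=> y.
have /andP[y0 y1] : 0 < y < 1.
  near: y; have := @near_in_itvoo R 0 1 x; rewrite in_itv /= => /(_ x01).
  by apply: filterS => y; rewrite in_itv.
rewrite (cdf_Rint Ff) ?ltW//; apply: eq_Rintegral => t; rewrite inE /= in_itv /= => /andP[t0 ty].
by rewrite /fD patchE mem_set//= in_itv /= t0 (le_trans ty)// ltW.
Unshelve. all: by end_near. Qed.

(** [h] is a pointwise derivative, computed only where [F1] has derivative [f]; the exceptional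
    points and both ends form a null set. *)
Lemma eq_Rintegral_derive (u w : R -> R) (v : R) : 0 <= v <= 1 ->
  (forall x : R, 0 < x < 1 -> is_derive x 1 F (f x) -> u x = w x) ->
  \int[mu]_(x in `[0, v]) u x = \int[mu]_(x in `[0, v]) w x.
Proof.
move=> /andP[v0 v1] uw; rewrite /Rintegral; congr fine.
have [A [mA A0 AP]] := cdf_ae_derive.
have m01 : measurable ([set 0; 1] : set R) by exact: measurableU.
apply: (@integral_null_eq _ _ (A `|` [set 0; 1])) => //; first exact: measurableU.
  rewrite measureU0//.
  by apply/countable_lebesgue_measure0/finite_set_countable; exact: finite_set2.
move=> x /=; rewrite in_itv /= => /andP[x0 xv] /not_orP[nA /not_orP[/eqP xN0 /eqP xN1]].
have x01 : 0 < x < 1.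
  by rewrite lt_neqAle eq_sym xN0 x0 lt_neqAle xN1 (le_trans xv).
congr EFin; apply: uw => //.
by apply: contrapT => nd; apply: nA; apply: AP => /= /(_ x01).
Qed.

End DensityDerive.

Section PredictorDensity.
Variables (R : realType) (F : predictor R).
Notation mu := (@lebesgue_measure R).

Let itv_setX_measurable (v : R) : measurable ((`]-oo, v] : set R) `*` (setT : set R)).
Proof. exact: measurableX. Qed.

Lemma F1_nondecreasing : {homo F1 F : x y / x <= y}.
Proof.
move=> x y xy; rewrite /F1 /marginal1 fine_le ?fin_num_measure//.
rewrite le_measure ?inE// => -[a b] [/= ax _]; split=> //=.
by move: ax; rewrite !in_itv /= => /le_trans; exact.
Qed.

Lemma F1_at1 : F1 F 1 = 1.
Proof.
have m1 := itv_setX_measurable 1.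
rewrite /F1 /marginal1 (_ : law F _ = 1%E)//; apply/eqP; rewrite eq_le.
rewrite probability_le1//= -(law_unit_square F) le_measure ?inE//.
  exact: measurableX.
by move=> [a b] [/=]; rewrite !in_itv /= => /andP[_ ->].
Qed.

(** The sign of [f1] is known on []0, 1]] only, so it is set to 0 elsewhere; within [[0, 1]] this
    alters one point. *)
Lemma cdf_density_f1 : cdf_density (F1 F) (f1 F \_ `]0, 1]).
Proof.
have [mf1 f1_gt0 F1E] := f1_density F.
split.
- apply/(measurable_restrictT _ _).1 => //.
  by apply: measurable_funS mf1 => //; apply: subset_itvScc; rewrite bnd_simp.
- move=> x; rewrite patchE; case: ifPn => // /set_mem /=; rewrite in_itv /= => x01.
  by rewrite ltW// f1_gt0.
- by move=> x x01; rewrite patchE mem_set//=; exact: f1_gt0.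
- move=> x /andP[x0 x1]; rewrite [LHS]F1E ?x0//.
  apply: (@integral_null_eq _ _ [set 0]) => //; first exact: lebesgue_measure_set1.
  move=> t /=; rewrite in_itv /= => /andP[t0 tx] /eqP tN0.
  rewrite patchE mem_set//= in_itv /= lt_neqAle eq_sym tN0 t0/=.
  exact: le_trans x1.
- by split; [exact: nondecreasing_measurable F1_nondecreasing|exact: F1_at1].
Qed.

Lemma f1_patch x : 0 < x <= 1 -> f1 F x = (f1 F \_ `]0, 1]) x.
Proof. by move=> x01; rewrite patchE mem_set. Qed.

End PredictorDensity.

Lemma eq_cube_integral (R : realType) (k : nat) (a : R) (u v : seq R -> R) :
  (forall w, size w = k -> all (fun x => 0 <= x <= a) w -> u w = v w) ->
  cube_integral k a u = cube_integral k a v.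
Proof.
elim: k u v => [|k IH] u v uv /=; first by rewrite uv.
apply: eq_integral => t; rewrite inE /= in_itv /= => t0a.
by apply: IH => w sw aw; apply: uv; rewrite /= ?sw ?t0a.
Qed.

Lemma maxval_itv (R : realType) (w : seq R) :
  all (fun x => 0 <= x <= 1) w -> 0 <= maxval w <= 1.
Proof.
rewrite /maxval; elim: w => [|t w IH] /=; first by rewrite big_nil lexx ler01.
by move=> /andP[t01 /IH w01]; rewrite big_cons max_itv.
Qed.

Section Equilibrium.
Variables (R : realType) (m n p : nat) (F : predictor R).
Variable psi : nat -> nat -> predictor R -> seq R -> R.
Hypothesis n_ge2 : (2 <= n)%N.
Hypothesis gE : forall v, g m F psi n v =
  'C(p + n, p)%:R * F1 F (minval v) ^+ p * \prod_(x <- v) f1 F x.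
Notation mu := (@lebesgue_measure R).

Let f := f1 F \_ `]0, 1].
Let Ff : cdf_density (F1 F) f := cdf_density_f1 F.
Let N := (p + n.-1)%N.

(** In the quantile scale, the conditional density at [u] of the highest rival quantile given an own
    quantile [u]; [h_diag] adds the Jacobian [f x]. *)
Definition hazard (u : R) : R := N%:R * u ^+ N.-1 / (1 - (bsum N p (1 : R)).[u]).

Lemma bsum_lt1 u : 0 < u <= 1 -> (bsum N p (1 : R)).[u] < 1.
Proof.
move=> /andP[u0 u1]; rewrite -subr_gt0.
by rewrite (lt_le_trans _ (bsum_lower p n.-1 _))// ?exprn_gt0// ltW.
Qed.

(** As [n >= 2], [N - 1 >= p], so the power in the numerator is at most [u ^ p], which [bsum_lower]
    puts below the denominator. *)
Lemma hazard_itv u : 0 <= u <= 1 -> 0 <= hazard u <= N%:R.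
Proof.
move=> u01; have lower := bsum_lower p n.-1 u01; have /andP[u0 u1] := u01.
have up : 0 <= u ^+ p by exact: exprn_ge0.
rewrite /hazard; apply/andP; split.
  by rewrite !mulr_ge0 ?exprn_ge0 ?invr_ge0// (le_trans up).
have [->|d0] := eqVneq (1 - (bsum N p (1 : R)).[u]) 0; first by rewrite invr0 mulr0.
rewrite ler_pdivrMr; last by rewrite lt_neqAle eq_sym d0 (le_trans up).
rewrite ler_wpM2l// (le_trans _ lower)//.
have -> : (N.-1 = p + n.-2)%N by rewrite /N; lia.
by rewrite exprD ler_piMr// exprn_ile1.
Qed.

(** Given [x], the highest rival valuation has distribution function [D * (F1 y ^ N - rest y)]. By
    [bsum_quadratic], [rest] is of second order at [y = x], so only [F1 ^ N] contributes to the
    derivative. *)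
Lemma h_diag (x : R) : 0 < x < 1 -> is_derive x 1 (F1 F) (f x) ->
  h m F psi n x x = hazard (F1 F x) * f x.
Proof.
move=> /andP[x0 x1] dF; set u := F1 F x.
have x01 : 0 <= x <= 1 by rewrite !ltW.
have o01 : 0 <= (1:R) <= 1 by rewrite ler01 lexx.
have u01 := cdf_itv Ff x01.
have u_gt0 : 0 < u by rewrite -(cdf0 Ff) (cdf_lt Ff)// ltW.
have f1_0 : 0 < f1 F x by have [_ f1p _] := f1_density F; rewrite f1p// x0 ltW.
have C0 : 'C(p + n, p)%:R != 0 :> R by exact: binC_neq0.
have C0' : 'C(p + n.-1, p)%:R != 0 :> R by exact: binC_neq0.
have k0 : (0 < n.-1)%N by rewrite -subn1 subn_gt0.
have b1 : (bsum N p (1 : R)).[u] < 1 by apply: bsum_lt1; rewrite u_gt0; case/andP: u01.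
have gcons w : g m F psi n (x :: w) = 'C(p + n, p)%:R * f1 F x *
    F1 F (Num.min x (minval w)) ^+ p * \prod_(t <- w) f1 F t.
  by rewrite gE /minval !big_cons; ring.
have marginalE : fine (cube_integral n.-1 1 (fun w => g m F psi n (x :: w))) =
    'C(p + n, p)%:R * f1 F x * (phi p n.-1 (1 : R)).[u].
  under eq_fun do rewrite gcons.
  rewrite (cube_integral_min Ff (@f1_patch _ F))// ?k0//= (cdf1 Ff) min_l//; exact: ltW.
have phi_gt0 : (phi p n.-1 (1 : R)).[u] != 0.
  rewrite hornerphi expr1n mulf_neq0 ?invr_eq0 ?binC_neq0// subr_eq0 gt_eqF//.
have HE y : 0 < y < 1 -> H m F psi n y x =
    (1 - (bsum N p (1 : R)).[u])^-1 * (F1 F y ^+ N - (bsum N p (F1 F y)).[Num.min u (F1 F y)]).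
  move=> /andP[y0 y1]; have y01 : 0 <= y <= 1 by rewrite !ltW.
  have belE w : belief m F psi n x w =
      (phi p n.-1 (1 : R)).[u]^-1 * F1 F (Num.min x (minval w)) ^+ p * \prod_(t <- w) f1 F t.
    by rewrite /belief marginalE gcons; field; rewrite phi_gt0 C0 gt_eqF.
  rewrite /H (funext belE).
  rewrite (cube_integral_min Ff (@f1_patch _ F))// ?k0//=.
  have Fmin : F1 F (Num.min x y) = Num.min u (F1 F y).
    have [xy|/ltW yx] := leP x y.
      by rewrite min_l//; exact: F1_nondecreasing xy.
    by rewrite min_r//; exact: F1_nondecreasing yx.
  rewrite Fmin !hornerphi expr1n -/N; field.
  by rewrite C0' subr_eq0 gt_eqF.
have [L L0 quad] := @bsum_quadratic R p n.-2.
rewrite prednK// in quad.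
set D := (1 - (bsum N p (1 : R)).[u])^-1.
pose rest y := (bsum N p (F1 F y)).[Num.min u (F1 F y)].
have near01 : \forall y \near x, 0 < y < 1.
  have := @near_in_itvoo R 0 1 x; rewrite in_itv /= x0 x1 => /(_ isT).
  by apply: filterS => y; rewrite in_itv.
have drest : is_derive x 1 rest 0.
  apply: (is_derive_quadratic (L := L) dF).
    by rewrite /rest /u min_l// bsum_at// leq_addr.
  apply: filterS near01 => y /andP[y0 y1]; apply: quad => //.
  by apply: (cdf_itv Ff); rewrite !ltW.
have dH : is_derive x 1 (D \*: (F1 F ^+ N - rest)) (D *: ((N%:R * u ^+ N.-1) *: f x - 0)).
  by apply: is_deriveZ; apply: is_deriveB.
have dHx : is_derive x 1 (fun y => H m F psi n y x) (D *: ((N%:R * u ^+ N.-1) *: f x - 0)).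
  apply: near_eq_is_derive dH; apply: filterS near01 => y y01.
  by rewrite HE// /D /rest !fctE.
have [_ dHE] := dHx.
rewrite /h derive1E dHE subr0 /hazard /D /GRing.scale /=; ring.
Qed.

Definition bid_rate (x : R) : R := x * hazard (F1 F x) * f x.

Let hazard_le x : 0 <= x <= 1 -> `|x * hazard (F1 F x)| <= N%:R.
Proof.
move=> x01; have /andP[h0 hN] := hazard_itv (cdf_itv Ff x01).
have /andP[x0 x1] := x01.
rewrite ger0_norm; last exact: mulr_ge0.
by rewrite -[N%:R]mul1r ler_pM.
Qed.

Let measurable_hazard : measurable_fun setT (fun x : R => x * hazard (F1 F x)).
Proof.
apply: measurable_funM => //; apply: measurableT_comp (cdf_density_measurable Ff).
rewrite /hazard; apply: measurable_funM.
  by apply: measurable_funM => //; exact: measurable_funX.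
apply: (@measurableT_comp _ _ _ _ _ _ (@GRing.inv R)).
  exact: measurable_inv.
apply: measurable_funB => //; exact: measurable_horner.
Qed.

Lemma integrable_bid_rate : mu.-integrable `[0, 1] (EFin \o bid_rate).
Proof.
have := @integrable_density_mul _ _ _ Ff (fun x => x * hazard (F1 F x)) N%:R 0 1.
by apply.
Qed.

Lemma sigmaAPE v : 0 <= v <= 1 ->
  sigmaAP m F psi n v = \int[mu]_(x in `[0, v]) bid_rate x.
Proof.
move=> v01; apply: (eq_Rintegral_derive Ff) => // x x01 dF.
by rewrite (h_diag x01 dF) /bid_rate mulrA.
Qed.

(** This is [cube_integral_max] with [k = n]; its factor [1 / 'C(p + n, p)] cancels the
    normalization of [g]. *)
Lemma HBE : HB m F psi n =
  (\int[mu]_(x in `[0, 1]) (bid_rate x * (1 - F1 F x ^+ (p + n))))%:E.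
Proof.
have n0 : (0 < n)%N by exact: ltnW.
transitivity (cube_integral n 1 (fun v : seq R =>
    'C(p + n, p)%:R * (\int[mu]_(x in `[0, maxval v]) bid_rate x) *
    F1 F (minval v) ^+ p * \prod_(x <- v) f1 F x)).
  apply: eq_cube_integral => w _ w01.
  by rewrite sigmaAPE ?maxval_itv// gE; ring.
rewrite (cube_integral_max Ff (@f1_patch _ F) integrable_bid_rate)//.
by rewrite divff ?binC_neq0// mul1r.
Qed.

End Equilibrium.

(** * Perfect predictor *)

Section Perfect.
Variables (R : realType) (m : nat) (F : predictor R).
Notation mu := (@lebesgue_measure R).

Lemma g_perfectE n v : (n <= m)%N -> g m F (@psi_perfect R) n v =
  'C(m - n + n, m - n)%:R * F1 F (minval v) ^+ (m - n) * \prod_(x <- v) f1 F x.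
Proof. by move=> nm; rewrite subnK// bin_sub. Qed.

(** The integrands differ only in the denominators of [hazard]: at [n] fewer binomial terms are
    subtracted from 1 than at 2, so the rate is smaller at every interior point. *)
Lemma HB_perfect_lt n : (2 < n <= m)%N ->
  (HB m F (@psi_perfect R) n < HB m F (@psi_perfect R) 2)%E.
Proof.
move=> /andP[n2 nm]; have m2 : (2 <= m)%N by rewrite (leq_trans _ nm)// ltnW.
have Ff := cdf_density_f1 F.
have int k (k2 : (2 <= k)%N) :=
  integrable_mul_oneB_cdfX Ff (integrable_bid_rate (m - k) F k2) m.
rewrite (HBE (ltnW n2) (fun v => g_perfectE v nm)).
rewrite (HBE (leqnn 2) (fun v => g_perfectE v m2)) !subnK// lte_fin.
apply: Rintegral_lt => //; [exact: int (ltnW n2)|exact: int|move=> x /andP[x0 x1]].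
have /andP[u0 u1] : 0 < F1 F x < 1.
  by rewrite -(cdf0 Ff) -(cdf1 Ff) !(cdf_lt Ff)// ltW.
have um : F1 F x ^+ m < 1 by rewrite exprn_ilt1 ?(ltW u0)// -lt0n (leq_trans _ m2).
rewrite ltr_pM2r ?subr_gt0//.
rewrite /bid_rate ltr_pM2r; last first.
  by case: Ff => _ _ f0 _ _; rewrite f0// x0 ltW.
rewrite ltr_pM2l// /hazard.
have p1 := @bsum_lt1 R n (m - n) (F1 F x); have p2 := @bsum_lt1 R 2 (m - 2) (F1 F x).
have EN : (m - n + n.-1 = m.-1)%N by lia.
have E2 : (m - 2 + 2.-1 = m.-1)%N by lia.
have lt2 : (m - n < m - 2 <= m.-1)%N by lia.
have N0 : (0 < m.-1)%N by lia.
rewrite EN in p1 *; rewrite E2 in p2 *.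
have u01 : 0 < F1 F x <= 1 by rewrite u0 ltW.
rewrite ltr_pM2l ?mulr_gt0 ?exprn_gt0 ?ltr0n//.
rewrite ltf_pV2 ?posrE ?subr_gt0 ?p1 ?p2// ltrD2l ltrN2.
by rewrite bsum_lt// u0.
Qed.

Lemma HB_maximizer_perfect n : (2 <= m)%N ->
  HB_maximizer m F (@psi_perfect R) n <-> n = 2%N.
Proof.
move=> m2; split=> [[/andP[n2 nm] opt]|->].
  apply/eqP; rewrite eqn_leq n2 andbT leqNgt; apply/negP => lt2n.
  have := opt 2%N; rewrite leqnn m2 => /(_ isT); apply/negP; rewrite -ltNge.
  by rewrite HB_perfect_lt// lt2n.
split=> [|k /andP[k2 km]]; first by rewrite leqnn.
have [->//|kn2] := eqVneq k 2%N.
by rewrite ltW// HB_perfect_lt// km andbT ltn_neqAle eq_sym kn2.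
Qed.

End Perfect.

(** * Null predictor with a power prior *)

Section PowerIntegral.
Variable R : realType.
Notation mu := (@lebesgue_measure R).

Lemma powR_cvg_at_right0 (a : R) : 0 < a -> x `^ a @[x --> 0^'+] --> (0 : R).
Proof.
move=> a0; apply/cvgr0Pnorm_lt => e e0; near=> x.
have x0 : 0 < x by near: x; exact: nbhs_right_gt.
rewrite ger0_norm ?powR_ge0//.
have -> : e = (e `^ a^-1) `^ a by rewrite -powRrM mulVf ?gt_eqF// powRr1 ?ltW.
rewrite gt0_ltr_powR ?nnegrE ?powR_ge0 ?(ltW x0)//.
by near: x; apply: nbhs_right_lt; exact: powR_gt0.
Unshelve. all: by end_near. Qed.

Lemma powR_continuous_at (a x : R) : 0 < x -> {for x, continuous (@powR R ^~ a)}.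
Proof.
move=> x0; apply: differentiable_continuous; apply/derivable1_diffP.
by have [] := is_derive1_powR a x0.
Qed.

Lemma powR_within_continuous (a : R) : 0 < a ->
  {within `[0, 1], continuous (@powR R ^~ a)}.
Proof.
move=> a0; apply/continuous_within_itvP => //; split.
- by move=> x; rewrite in_itv /= => /andP[x0 _]; exact: powR_continuous_at.
- by rewrite powR0 ?gt_eqF//; exact: powR_cvg_at_right0.
- apply: cvg_at_left_filter; exact: powR_continuous_at.
Qed.

Lemma integrable_powR (a : R) : 0 < a -> mu.-integrable `[0, 1] (EFin \o (@powR R ^~ a)).
Proof.
move=> a0; apply: continuous_compact_integrable; first exact: segment_compact.
exact: powR_within_continuous.
Qed.

Lemma Rintegral_powR (a : R) : 0 < a -> \int[mu]_(x in `[0, 1]) (x `^ a) = (a + 1)^-1.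
Proof.
move=> a0; have a10 : 0 < a + 1 by rewrite addr_gt0.
pose P := (a + 1)^-1 \*: (@powR R ^~ (a + 1)).
have dP (x : R) : 0 < x -> is_derive x 1 P (x `^ a).
  move=> x0; have -> : x `^ a = (a + 1)^-1 *: ((a + 1) * x `^ (a + 1 - 1)).
    by rewrite addrK /GRing.scale /= mulrA mulVf ?mul1r ?gt_eqF.
  by apply: is_deriveZ; exact: is_derive1_powR.
rewrite /Rintegral (@continuous_FTC2 _ _ P) //.
- by rewrite /P /= powR1 powR0 ?gt_eqF// scaler0 subr0 /GRing.scale /= mulr1.
- exact: powR_within_continuous.
- split.
  + by move=> x; rewrite in_itv /= => /andP[x0 _]; have [] := dP x x0.
  + rewrite /P /= powR0 ?gt_eqF//; apply: cvgZl_tmp.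
    exact: powR_cvg_at_right0.
  + apply: cvg_at_left_filter; apply: cvgZl_tmp; exact: powR_continuous_at.
- by move=> x; rewrite in_itv /= => /andP[x0 _]; rewrite derive1E; have [] := dP x x0.
Qed.

End PowerIntegral.

Section NullPower.
Variables (R : realType) (m : nat) (F : predictor R) (c : R).
Hypotheses (c0 : 0 < c) (F1E : forall x : R, 0 <= x <= 1 -> F1 F x = x `^ c).
Notation mu := (@lebesgue_measure R).

Let Ff := cdf_density_f1 F.

Lemma g_nullE n v : (n <= m)%N -> g m F (@psi_null R) n v =
  'C(0 + n, 0)%:R * F1 F (minval v) ^+ 0 * \prod_(x <- v) f1 F x.
Proof.
move=> nm; rewrite /g /psi_null bin0 expr0 !mul1r mulfV ?mul1r//.
by rewrite pnatr_eq0 -lt0n bin_gt0.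
Qed.

(** The integral over [[0, 1]] of [(n - 1) c (x ^ ((n - 1) c) - x ^ ((2 n - 1) c))]. *)
Definition null_bid (n : nat) : R := c ^+ 2 * n%:R * (n%:R - 1) /
  (((n%:R - 1) * c + 1) * ((2 * n%:R - 1) * c + 1)).

Let density_power (x : R) : 0 < x < 1 ->
  is_derive x 1 (F1 F) ((f1 F \_ `]0, 1]) x) -> (f1 F \_ `]0, 1]) x = c * x `^ (c - 1).
Proof.
move=> x01 [_ <-]; have /andP[x0 _] := x01.
have [_ <-] := is_derive1_powR c x0; apply: near_eq_derive.
have := @near_in_itvoo R 0 1 x; rewrite in_itv /= => /(_ x01).
by apply: filterS => y; rewrite in_itv /= => /andP[y0 y1]; rewrite F1E// !ltW.
Qed.

Lemma HB_null n : (2 <= n <= m)%N -> HB m F (@psi_null R) n = (null_bid n)%:E.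
Proof.
move=> /andP[n2 nm]; rewrite (HBE n2 (fun v => g_nullE v nm)); congr EFin.
case: n n2 nm => [//|[//|k]] _ _.
(* With [n = k + 2] these are [(n - 1) c] and [(2 n - 1) c]. As [p = 0], [hazard u] is
   [(n - 1) u ^ (n - 2)]. *)
set a : R := k.+1%:R * c; set b : R := (2 * k + 3)%:R * c.
have a0 : 0 < a by rewrite mulr_gt0.
have b0 : 0 < b by rewrite mulr_gt0// ltr0n addnS.
have -> : \int[mu]_(x in `[0, 1]) (bid_rate k.+2 0 F x * (1 - F1 F x ^+ (0 + k.+2))) =
    \int[mu]_(x in `[0, 1]) (a * (x `^ a - x `^ b)).
  apply: (eq_Rintegral_derive Ff); first by rewrite ler01 lexx.
  move=> x x01 dF; have /andP[x0 x1] := x01.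
  rewrite /bid_rate density_power// /hazard /bsum big_ord0 horner0 subr0 divr1.
  rewrite F1E ?(ltW x0) ?(ltW x1)// !add0n /=.
  have uX j : (x `^ c) ^+ j = x `^ (j%:R * c).
    by rewrite -powR_mulrn ?powR_ge0// -powRrM mulrC.
  have xc : x * x `^ (c - 1) = x `^ c.
    by rewrite -[X in X * _](powRr1 (ltW x0)) -powRD ?(gt_eqF x0) ?implybT// addrC subrK.
  rewrite -!uX.
  transitivity (k.+1%:R * c * ((x `^ c) ^+ k * (x * x `^ (c - 1))) *
     (1 - (x `^ c) ^+ k.+2)); first by ring.
  rewrite xc -exprSr -mulrA mulrBr mulr1 -exprD.
  by rewrite (_ : (k.+1 + k.+2 = 2 * k + 3)%N)//; lia.
rewrite RintegralZl//; last first.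
  have := integrableB _ (integrable_powR a0) (integrable_powR b0).
  by move=> /(_ (measurable_itv _)).
rewrite RintegralB ?Rintegral_powR//; [|exact: integrable_powR|exact: integrable_powR].
have a1 : a + 1 != 0 by rewrite gt_eqF// addr_gt0.
have b1 : b + 1 != 0 by rewrite gt_eqF// addr_gt0.
have aE : (k.+2%:R - 1) * c = a by rewrite /a -addn1 natrD addrK.
have bE : (2 * k.+2%:R - 1) * c = b.
  by rewrite /b (_ : (2 * k + 3 = 2 * k.+2 - 1)%N) ?natrB ?natrM//; lia.
have kE : c * k.+2%:R = b - a by rewrite -aE -bE; ring.
rewrite /null_bid aE bE.
have -> : c ^+ 2 * k.+2%:R * (k.+2%:R - 1) = (c * k.+2%:R) * ((k.+2%:R - 1) * c) by ring.
rewrite aE kE; field; by rewrite a1 b1.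
Qed.

Lemma null_bid_step n : (1 <= n)%N -> exists2 d, 0 < d &
  null_bid n.+1 - null_bid n = d * (c ^+ 2 - c + 2 - n%:R * (c ^+ 2 - 3 * c)).
Proof.
move=> n1; set x : R := n%:R.
have x1 : 1 <= x by rewrite ler1n.
have p1 : 0 < (x - 1) * c + 1 by rewrite ltr_wpDl// mulr_ge0 ?(ltW c0) ?subr_ge0.
have p2 : 0 < (2 * x - 1) * c + 1 by rewrite ltr_wpDl// mulr_ge0 ?(ltW c0)//; lra.
have p3 : 0 < x * c + 1 by rewrite ltr_wpDl// mulr_ge0 ?(ltW c0)//; lra.
have p4 : 0 < (2 * x + 1) * c + 1 by rewrite ltr_wpDl// mulr_ge0 ?(ltW c0)//; lra.
(* The denominator collects the four factors in the denominators of [null_bid n] and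
   [null_bid n.+1]. *)
exists (c ^+ 2 * x / (((x - 1) * c + 1) * ((2 * x - 1) * c + 1) *
  (x * c + 1) * ((2 * x + 1) * c + 1))).
  rewrite divr_gt0 ?mulr_gt0//; lra.
rewrite /null_bid -natr1 -/x (_ : 2 * (x + 1) - 1 = 2 * x + 1); last by ring.
rewrite addrK; field.
by rewrite !gt_eqF.
Qed.

Lemma null_bid_lt n : (1 <= n)%N ->
  (null_bid n < null_bid n.+1) = (n%:R * (c ^+ 2 - 3 * c) < c ^+ 2 - c + 2).
Proof.
move=> n1; have [d d0 E] := null_bid_step n1.
by rewrite -subr_gt0 E pmulr_rgt0// subr_gt0.
Qed.

Lemma null_bid_gt n : (1 <= n)%N ->
  (null_bid n.+1 < null_bid n) = (c ^+ 2 - c + 2 < n%:R * (c ^+ 2 - 3 * c)).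
Proof.
move=> n1; have [d d0 E] := null_bid_step n1.
by rewrite -subr_lt0 E pmulr_rlt0// subr_lt0.
Qed.

End NullPower.

(** * Unimodal sequences and their maximizers *)

Section Unimodal.
Variables (R : realType) (V : nat -> R).

Lemma chain_lt a b : (a < b)%N -> (forall k, (a <= k < b)%N -> V k < V k.+1) -> V a < V b.
Proof.
elim: b => [//|b IH]; rewrite ltnS => ab Vlt.
have Vb : V b < V b.+1 by rewrite Vlt// ab ltnSn.
move: ab; rewrite leq_eqVlt => /predU1P[->//|ab].
rewrite (lt_trans _ Vb)// IH// => k /andP[ak kb].
by rewrite Vlt// ak ltnS ltnW.
Qed.

Lemma chain_le a b : (a <= b)%N -> (forall k, (a <= k < b)%N -> V k <= V k.+1) -> V a <= V b.
Proof.
elim: b => [|b IH]; first by rewrite leqn0 => /eqP ->.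
move=> ab Vle; move: (ab); rewrite leq_eqVlt => /predU1P[->//|]; rewrite ltnS => {}ab.
apply: (@le_trans _ _ (V b)); last by rewrite Vle// ab ltnSn.
by rewrite IH// => k /andP[ak kb]; rewrite Vle// ak ltnS ltnW.
Qed.

End Unimodal.

(** Values climb along a chain to the peak, which is [m] when the range stops before [U]; the
    descending side is a chain for [- V]. *)
Lemma unimodal_lt (R : realType) (V : nat -> R) (U m k : nat) :
  (forall j, (2 <= j < U)%N -> (j < m)%N -> V j < V j.+1) ->
  (forall j, (U <= j < m)%N -> V j.+1 < V j) ->
  (2 <= k <= m)%N -> k != minn m U -> V k < V (minn m U).
Proof.
move=> Vup Vdown /andP[k2 km]; rewrite neq_ltn => /orP[].
  rewrite leq_min => /andP[km' kU].
  apply: chain_lt => [|j /andP[kj]]; rewrite leq_min; first by rewrite km'.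
  by move=> /andP[jm jU]; rewrite Vup// jU (leq_trans k2).
rewrite gtn_min ltnNge km /= => Uk.
have -> : minn m U = U by apply/minn_idPr; rewrite (leq_trans (ltnW Uk)).
rewrite -ltrN2; apply: (@chain_lt _ (fun j => - V j)) => // j /andP[Uj jk].
by rewrite ltrN2 Vdown// Uj (leq_trans jk).
Qed.

Lemma unimodal_le (R : realType) (V : nat -> R) (U m k : nat) :
  (forall j, (2 <= j < U)%N -> V j <= V j.+1) ->
  (forall j, (U <= j)%N -> V j.+1 <= V j) ->
  (2 <= k <= m)%N -> V k <= V (minn m U).
Proof.
move=> Vup Vdown /andP[k2 km].
have [kU|Uk] := leqP k (minn m U).
  apply: chain_le => // j /andP[kj]; rewrite leq_min => /andP[jm jU].
  by rewrite Vup// jU (leq_trans k2).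
move: Uk; rewrite gtn_min ltnNge km /= => Uk.
have -> : minn m U = U by apply/minn_idPr; rewrite (leq_trans (ltnW Uk)).
rewrite -lerN2; apply: (@chain_le _ (fun j => - V j)); first exact: ltnW.
by move=> j /andP[Uj jk]; rewrite lerN2 Vdown.
Qed.

Section Maximizer.
Variables (R : realType) (m : nat) (F : predictor R).
Variable psi : nat -> nat -> predictor R -> seq R -> R.
Variable V : nat -> R.
Hypothesis HBV : forall n, (2 <= n <= m)%N -> HB m F psi n = (V n)%:E.

Lemma HB_maximizer_le n0 : (2 <= n0 <= m)%N ->
  (forall k, (2 <= k <= m)%N -> V k <= V n0) -> HB_maximizer m F psi n0.
Proof. by move=> n02m Vmax; split=> // k k2m; rewrite !HBV// lee_fin Vmax. Qed.

Lemma HB_maximizer_lt n0 : (2 <= n0 <= m)%N ->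
  (forall k, (2 <= k <= m)%N -> k != n0 -> V k < V n0) ->
  forall n, HB_maximizer m F psi n <-> n = n0.
Proof.
move=> n02m Vmax n; split=> [[n2m opt]|->]; last first.
  apply: HB_maximizer_le => // k k2m.
  by have [->//|kn] := eqVneq k n0; rewrite ltW// Vmax.
apply/eqP; apply: contraT => nn0.
by have := opt _ n02m; rewrite !HBV// lee_fin leNgt Vmax.
Qed.

End Maximizer.

(** * Optimal number of bidders for the null predictor *)

Section NullMaximizer.
Variables (R : realType) (m : nat) (F : predictor R) (c : R).
Hypotheses (m2 : (2 <= m)%N) (c0 : 0 < c)
  (F1E : forall x : R, 0 <= x <= 1 -> F1 F x = x `^ c).

Let opt := HB_maximizer m F (@psi_null R).
Let V := null_bid c.
Let t := (c ^+ 2 - c + 2) / (c ^+ 2 - 3 * c).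
Let cbar : R := (5 + Num.sqrt 33) / 2.

Let HBV := HB_null (m := m) c0 F1E.

Let minn2m U : (2 <= U)%N -> (2 <= minn m U <= m)%N.
Proof. by move=> U2; rewrite leq_min m2 U2 geq_minl. Qed.

Lemma HB_maximizer_null_small n : c <= 3 -> opt n <-> n = m.
Proof.
move=> c3; apply: (HB_maximizer_lt HBV) => [|k k2m]; first by rewrite m2 leqnn.
rewrite -{1 2}[m]minnn; apply: unimodal_lt => //; last by move=> j; lia.
move=> j /andP[j2 jm] _; rewrite null_bid_lt//; last exact: ltnW.
have j1 : 1 <= j%:R :> R by rewrite ler1n ltnW.
have cc : c * (c - 3) <= 0 by rewrite mulr_ge0_le0 ?subr_le0// ltW.
(* This reduces the criterion for an upward step to [c ^ 2 - 3 c < c ^ 2 - c + 2]. *)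
have jcc : (j%:R - 1) * (c * (c - 3)) <= 0 by rewrite mulr_ge0_le0// subr_ge0.
have cp := c0; lra.
Qed.

Let sqrt33 : Num.sqrt 33 ^+ 2 = 33 :> R. Proof. by rewrite sqr_sqrtr. Qed.

Lemma HB_maximizer_null_large : cbar <= c -> opt 2%N.
Proof.
move=> cc; have s0 := sqrtr_ge0 (33 : R).
(* [cbar] is the larger root of [c ^ 2 - 5 c - 2], which equals [2 (c ^ 2 - 3 c) - (c ^ 2 - c + 2)]:
   neither the step from 2 nor any later one goes up. *)
have q : 0 <= c ^+ 2 - 5 * c - 2.
  by have : cbar <= c := cc; have := sqrt33; rewrite /cbar; nra.
apply: (HB_maximizer_le HBV) => [|k k2m]; first by rewrite m2.
rewrite -(minn_idPr m2); apply: unimodal_le k2m => j; first by lia.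
move=> j2; rewrite leNgt null_bid_lt//; last exact: ltnW.
have j2' : 2 <= j%:R :> R by rewrite ler_nat.
by rewrite -leNgt; nra.
Qed.

Lemma HB_maximizer_null_larger n : cbar < c -> opt n -> n = 2%N.
Proof.
move=> cc; have s0 := sqrtr_ge0 (33 : R).
have q : 0 < c ^+ 2 - 5 * c - 2.
  by have : cbar < c := cc; have := sqrt33; rewrite /cbar; nra.
apply: (HB_maximizer_lt HBV _ _ n).1 => [|k k2m]; first by rewrite m2.
rewrite -{1 2}(minn_idPr m2); apply: unimodal_lt => //; first by move=> j; lia.
move=> j /andP[j2 _]; rewrite null_bid_gt//; last exact: ltnW.
have j2' : 2 <= j%:R :> R by rewrite ler_nat.
nra.
Qed.

Section Intermediate.
Hypothesis c_itv : 3 < c < cbar.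

Let K0 : 0 < c ^+ 2 - 3 * c.
Proof. by case/andP: c_itv => ? _; nra. Qed.

(** Equivalent to [c ^ 2 - 5 c - 2 < 0], as the denominator is positive. It keeps an integer [t], or
    the ceiling of [t], at least 2. *)
Let t2 : 2 < t.
Proof.
rewrite /t ltr_pdivlMr//; have /andP[c3 cc] := c_itv.
have s0 := sqrtr_ge0 (33 : R); have := sqrt33; move: cc; rewrite /cbar; nra.
Qed.

Let V_lt n : (1 <= n)%N -> (V n < V n.+1) = (n%:R < t).
Proof. by move=> n1; rewrite /V null_bid_lt// /t ltr_pdivlMr. Qed.

Let V_gt n : (1 <= n)%N -> (V n.+1 < V n) = (t < n%:R).
Proof. by move=> n1; rewrite /V null_bid_gt// /t ltr_pdivrMr. Qed.

(** Steps before [k] go up, the step from [k] is flat and later ones do not go up. When [m <= k] the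
    tying value [k + 1] is out of range. *)
Lemma HB_maximizer_null_int k : t = k%:R ->
  opt (minn m k) /\ ((m <= k)%N -> forall n, opt n -> n = minn m k).
Proof.
move=> tk; have k2 : (2 <= k)%N by rewrite -(ler_nat R) -tk ltW.
split.
  apply: (HB_maximizer_le HBV) => [|j j2m]; first exact: minn2m.
  apply: unimodal_le j2m => i.
    move=> /andP[i2 ik]; rewrite ltW// V_lt ?(ltnW i2)//.
    by rewrite tk ltr_nat.
  move=> ki; rewrite leNgt V_lt ?(leq_trans (ltnW k2))//.
  by rewrite tk ltr_nat -leqNgt.
move=> mk n; apply: (HB_maximizer_lt HBV _ _ n).1; first exact: minn2m.
move=> j j2m; apply: unimodal_lt j2m; last by move=> i; lia.
move=> i /andP[i2 ik] _; rewrite V_lt ?(ltnW i2)//.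
by rewrite tk ltr_nat.
Qed.

(** The step from [i] goes up when [i < t] and down when [i > t]; as [t] is not an integer, the last
    upward step ends at its ceiling. *)
Lemma HB_maximizer_null_ceil n : t \isn't a Num.int ->
  opt n <-> n = minn m `|Num.ceil t|%N.
Proof.
move=> tint; set U := `|Num.ceil t|%N.
have ceil0 : (0 <= Num.ceil t)%R.
  by rewrite -(ler_int R) (le_trans _ (ceil_ge t))// ltW// (lt_trans _ t2).
have UE : U%:R = (Num.ceil t)%:~R :> R by rewrite -[in RHS](gez0_abs ceil0).
have tU : t < U%:R.
  rewrite lt_neqAle UE ceil_ge andbT; apply/eqP => tE.
  by move: tint; rewrite tE intr_int.
have Ut : U%:R < t + 1 by rewrite UE -ltrBlDr; have := ceilB1_lt t; rewrite intrB.
have U2 : (2 <= U)%N by rewrite -(ler_nat R) ltW// (lt_trans t2).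
apply: (HB_maximizer_lt HBV); first exact: minn2m.
move=> j j2m; apply: unimodal_lt j2m.
  move=> i /andP[i2 iU] _; rewrite V_lt ?(ltnW i2)//.
  have : i.+1%:R <= U%:R :> R by rewrite ler_nat.
  rewrite -natr1; lra.
move=> i /andP[Ui _]; rewrite V_gt ?(leq_trans (ltnW U2))//.
by rewrite (lt_le_trans tU)// ler_nat.
Qed.

End Intermediate.
End NullMaximizer.

(* Where the maximizer is unique, uniqueness is asserted. When [t] below is an
   integer (in particular at c = (5 + sqrt 33) / 2, where t = 2), [t] and [t + 1]
   tie, and the asserted value is claimed to be a maximizer. *)
Theorem proposition11 (R : realType) (m : nat) (F : predictor R) :
  (2 <= m)%N ->
  (perfect F -> SSM_exists m F (@psi_perfect R) ->
     forall n : nat, HB_maximizer m F (@psi_perfect R) n <-> n = 2%N)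
  /\
  (null F -> SSM_exists m F (@psi_null R) ->
     forall c : R, 0 < c -> (forall x : R, 0 <= x <= 1 -> F1 F x = x `^ c) ->
     let opt := HB_maximizer m F (@psi_null R) in
     let t := (c ^+ 2 - c + 2) / (c ^+ 2 - 3 * c) in
     let cbar := (5 + Num.sqrt 33) / 2 in
     [/\ c <= 3 -> forall n : nat, opt n <-> n = m,
         3 < c < cbar ->
           (forall k : nat, t = k%:R ->
              opt (minn m k) /\
              ((m <= k)%N -> forall n : nat, opt n -> n = minn m k)) /\
           (t \isn't a Num.int ->
              let up := minn m `|Num.ceil t|%N in
              let down := minn m `|Num.floor t|%N in
              (opt up \/ opt down) /\
              (forall n : nat, opt n -> n = up \/ n = down)),
         cbar <= c -> opt 2%N &
         cbar < c -> forall n : nat, opt n -> n = 2%N]).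

Proof.
move=> m2; split=> [_ _ n|_ _ c c0 F1E /=]; first exact: HB_maximizer_perfect.
split.
- by move=> c3 n; exact: (HB_maximizer_null_small m2 c0 F1E n c3).
- move=> c_itv; split=> [k tk|tint]; first exact: (HB_maximizer_null_int m2 c0 F1E c_itv tk).
  have optE n := HB_maximizer_null_ceil m2 c0 F1E c_itv n tint.
  (* The rounding up is always the maximizer, so the left alternative holds in both clauses. *)
  by split=> [|n /optE ->]; left=> //; exact/optE.
- exact: (HB_maximizer_null_large m2 c0 F1E).
- by move=> cc n; exact: (HB_maximizer_null_larger m2 c0 F1E).
Qed.
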